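(* Let $n\in\mathbb Z_{\ge 0}$, let $\alpha=(\alpha_i\in F\mid -\infty<i\le n-2)$ be an arbitrary sequence, and let $\alpha(x)=x^{-n}+\alpha_{n-2}x^{-n+1}+\dots+\alpha_0x^{-1}+\dots\in F(\!(x)\!)$ be the corresponding series. For an $(n,s)$-type series $r=\sum_{k\ge0}\sum_{i=1}^d f_{k,i}\otimes b_iy^k\in (L(n,\alpha)\otimes\mathfrak g)[\![y]\!]$ put $$W(r):=\mathrm{span}_F\{f_{k,i}\mid k\ge 0,\ 1\le i\le d\}\subseteq L(n,\alpha).$$ Then: 1. The assignment $r\mapsto W(r)$ is a bijection between series of type $\left(n,\frac{1}{x^n\alpha(x)}\right)$ and subspaces $V\subset L(n,\alpha)$ complementary to the diagonal $\Delta$, i.e. with $L(n,\alpha)=\Delta\dotplus V$. 2. For any series $r$ of type $\left(n,\frac{1}{x^n\alpha(x)}\right)$ one has $W(r)^\perp=W(\overline r)$ inside $L(n,\alpha)$ (orthogonal complement with respect to $B$). 3. Any series $r$ of type $\left(n,\frac{1}{x^n\alpha(x)}\right)$ satisfies $\mathrm{GCYB}(r)=\psi$, where $\psi\in(\mathfrak g\otimes\mathfrak g\otimes\mathfrak g)[\![x_1,x_2,x_3]\!]$ is defined by $$B(v_1\otimes v_2\otimes v_3,\psi)=B(v_1,[v_2,v_3])\quad\text{for all } v_1\in W(\overline r),\ v_2,v_3\in W(r).$$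
   Context: $F$ is an algebraically closed field of characteristic $0$, $\mathfrak g$ a finite-dimensional simple Lie algebra over $F$ with Killing form $\kappa$, $\{b_i\}_{i=1}^d$ a basis of $\mathfrak g$ orthonormal for $\kappa$, $\Omega=\sum_i b_i\otimes b_i$. $\dotplus$ denotes direct sum of vector spaces. **The algebra $L(n,\alpha)$.** For $n\ge0$ and $\alpha=(\alpha_i)_{i\le n-2}$ let $\alpha(x)=x^{-n}+\alpha_{n-2}x^{-n+1}+\dots+\alpha_0x^{-1}+\dots$ (the coefficient of $x^{-i-1}$ is $\alpha_i$; for $n=0$, $\alpha(x)=1+\alpha_{-2}x+\dots$). So $x^n\alpha(x)\in F[\![x]\!]^\times$. Let $A(n,\alpha)=F(\!(x)\!)\times F[x]/(x^n)$ (second factor zero if $n=0$), $L(n,\alpha)=\mathfrak g\otimes A(n,\alpha)=\mathfrak g(\!(x)\!)\times\mathfrak g[x]/x^n\mathfrak g[x]$ with the bracket $[a\otimes f,b\otimes g]=[a,b]\otimes fg$. Let $t(f,[p])=\mathrm{res}_0\{\alpha(x)(f-p)\}$ and $B(a\otimes u,b\otimes v)=\kappa(a,b)\,t(uv)$; $B$ is a symmetric non-degenerate invariant form. For $b\in\mathfrak g$ write $b(f,[p])$ for $b\otimes(f,[p])$. The diagonal is $\Delta=\{(f,[f])\mid f\in\mathfrak g[\![x]\!]\}\cong\mathfrak g[\![x]\!]$. $F[\![x]\!]$ acts on $L(n,\alpha)$ by $s\cdot(f,[p])=(sf,[sp])$. **Series of type $(n,s)$.** Elements of $(L(n,\alpha)\otimes\mathfrak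 g)[\![y]\!]$ are written $\sum_{k\ge0}\sum_i f_{k,i}\otimes b_iy^k$ with $f_{k,i}\in L(n,\alpha)$, where $y^k$ stands for $(y^k,[y]^k)$. One interprets $$\frac{y^n\Omega}{x-y}:=\sum_{k\ge0}\sum_{i=1}^d w_{k,i}\otimes b_iy^k,\qquad w_{k,i}=\begin{cases}b_i(0,-[x]^{n-1-k}),&0\le k\le n-1,\\ b_i(x^{n-1-k},0),&k\ge n.\end{cases}$$ $(\mathfrak g\otimes\mathfrak g)[\![x,y]\!]$ is viewed inside $(L(n,\alpha)\otimes\mathfrak g)[\![y]\!]$ via $\mathfrak g[\![x]\!]\cong\Delta$. For $s\in F[\![x]\!]^\times$, a series of type $(n,s)$ is $r=\frac{s(x)y^n\Omega}{x-y}+g(x,y)$ with $g\in(\mathfrak g\otimes\mathfrak g)[\![x,y]\!]$. Put $\overline r:=\frac{s(y)x^n\Omega}{x-y}-\tau(g(y,x))$, where $\tau$ is the $F[\![x,y]\!]$-linear extension of $a\otimes b\mapsto b\otimes a$; this is the $(n,s)$-type series $\frac{s(x)y^n\Omega}{x-y}-\frac{s(x)y^n-s(y)x^n}{x-y}\Omega-\tau(g(y,x))$, where $\frac{s(x)y^n-s(y)x^n}{x-y}\in F[\![x,y]\!]$. **GCYB.** Let $A_1=A(n,\alpha)$ in the variable $x_1$ and $A_m=A_{m-1}(\!(x_m)\!)\oplus A_{m-1}[x_m]/x_m^nA_{m-1}$. For $r=\sum f_{k,i}\otimes b_iy^k$ define in the associative algebra $U(\mathfrak g)^{\otimes3}\otimes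 A_3$: $r^{12}=\sum f_{k,i}(x_1)\otimes b_ix_2^k\otimes1$, $r^{13}=\sum f_{k,i}(x_1)\otimes1\otimes b_ix_3^k$, $r^{23}=\sum1\otimes f_{k,i}(x_2)\otimes b_ix_3^k$ (with $x_j^k$ standing for $(x_j^k,[x_j]^k)$), similarly for $\overline r$, and $$\mathrm{GCYB}(r)=[r^{12},r^{13}]+[r^{12},r^{23}]+[r^{13},\overline r^{23}].$$ $(\mathfrak g^{\otimes3})[\![x_1,x_2,x_3]\!]$ is embedded diagonally ($x_j\mapsto(x_j,[x_j])$). **The form on tensors.** The functional $t$ extends inductively to $A_m$ by $t\big(\sum_{k\ge -N} f_kx_m^k,\sum_{\ell<n}[g_\ell x_m^\ell]\big)=\sum_k t(f_k)t(x_m^k,0)+\sum_\ell t(g_\ell)t(0,[x_m]^\ell)$ (a finite sum), and $B$ extends to $\mathfrak g^{\otimes m}\otimes A_m$ by $B((a_1\otimes\dots\otimes a_m)\otimes f,(b_1\otimes\dots\otimes b_m)\otimes g)=t(fg)\prod_k\kappa(a_k,b_k)$. Thus, for $\psi=\sum c\; b_{i_1}x_1^{k_1}\otimes b_{i_2}x_2^{k_2}\otimes b_{i_3}x_3^{k_3}$, $B(v_1\otimes v_2\otimes v_3,\psi)=\sum c\prod_jB(v_j,b_{i_j}(x^{k_j},[x]^{k_j}))$, a finite sum. *)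

(* Defs.v *)
From HB Require Import structures.
From mathcomp Require Import all_boot all_order all_algebra.
From mathcomp Require Import zify.
From mathcomp Require Import boolp classical_sets functions cardinality fsbigop.

Set Implicit Arguments.
Unset Strict Implicit.
Unset Printing Implicit Defensive.

Import Order.TTheory GRing.Theory Num.Theory.

Local Open Scope classical_set_scope.
Local Open Scope ring_scope.

Section Convolution.
Variable R : comNzRingType.
Implicit Types f g h : nat -> R.

Definition conv f g (k : nat) : R := \sum_(i < k.+1) f i * g (k - i)%N.

Lemma conv_poly f g n k : (k < n)%N ->
  conv f g k = ((\poly_(i < n) f i) * (\poly_(i < n) g i))`_k.
Proof.
move=> kn; rewrite coefM; apply: eq_bigr => i _.
by rewrite !coef_poly !ifT// (leq_ltn_trans _ kn)// ?leq_subr// -ltnS.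
Qed.

Lemma convC f g k : conv f g k = conv g f k.
Proof. by rewrite !(conv_poly _ _ (ltnSn k)) mulrC. Qed.

Lemma convA f g h k : conv f (conv g h) k = conv (conv f g) h k.
Proof.
have E u v : conv (fun i => (\poly_(j < k.+1) u j)`_i) v k = conv u v k.
  apply: eq_bigr => i _; rewrite coef_poly ltn_ord.
  by [].
have E2 u v : conv u (fun i => (\poly_(j < k.+1) v j)`_i) k = conv u v k.
  by rewrite convC E convC.
transitivity (((\poly_(i < k.+1) f i) *
   ((\poly_(i < k.+1) g i) * (\poly_(i < k.+1) h i)))`_k).
  rewrite coefM; apply: eq_bigr => i _; rewrite coef_poly ltn_ord.
  by congr (_ * _); apply: conv_poly; rewrite ltnS leq_subr.
rewrite mulrA coefM; apply: eq_bigr => i _.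
rewrite coef_poly ltnS leq_subr; congr (_ * _).
by rewrite -conv_poly.
Qed.

End Convolution.

Section Laurent.
Variable R : comNzRingType.

(* Formal Laurent series R((x)). *)
Record laurent := Laurent {
  lcoef :> int -> R;
  lcoef_bounded : exists N : int, forall k, k < N -> lcoef k = 0 }.

HB.instance Definition _ := gen_eqMixin laurent.
HB.instance Definition _ := gen_choiceMixin laurent.

Implicit Types f g h : laurent.

Lemma laurentP f g : lcoef f =1 lcoef g -> f = g.
Proof.
case: f g => [f Pf] [g Pg] /= /funext E; subst g; congr Laurent.
exact: Prop_irrelevance.
Qed.

Lemma lfrom_subproof N (c : int -> R) :
  exists M : int, forall k, k < M -> (if k < N then 0 else c k) = 0.
Proof. by exists N => k ->. Qed.

(* the series \sum_(k >= N) c k x^k; the values of c below N are ignored *)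
Definition lfrom N (c : int -> R) : laurent := Laurent (lfrom_subproof N c).

Definition lmono (N : int) : laurent := lfrom N (fun k => (k == N)%:R).

Definition lser (c : nat -> R) : laurent := lfrom 0 (fun k => c `|k|%N).

Definition res f : R := f (-1).

Lemma ladd_subproof f g :
  exists N : int, forall k, k < N -> f k + g k = 0.
Proof.
have [N fN] := lcoef_bounded f; have [M gM] := lcoef_bounded g.
exists (Order.min N M) => k; rewrite lt_min => /andP[kN kM].
by rewrite fN// gM// addr0.
Qed.

Lemma lscale_subproof (c : R) f :
  exists N : int, forall k, k < N -> c * f k = 0.
Proof.
by have [N fN] := lcoef_bounded f; exists N => k /fN ->; rewrite mulr0.
Qed.

Lemma lopp_subproof f : exists N : int, forall k, k < N -> - f k = 0.
Proof.
by have [N fN] := lcoef_bounded f; exists N => k /fN ->; rewrite oppr0.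
Qed.

(* The sum is taken over the (finite) support of its summand. *)
Definition lmul_coef (f g : int -> R) (k : int) : R :=
  \sum_(i \in [set: int]) f i * g (k - i).

Lemma lmul_coefE (f g : int -> R) (N M : int) (k : nat) :
  (forall i, i < N -> f i = 0) -> (forall i, i < M -> g i = 0) ->
  lmul_coef f g (N + M + k%:Z) =
    conv (fun i => f (N + i%:Z)) (fun i => g (M + i%:Z)) k.
Proof.
move=> fN gM; pose r := [seq N + i%:Z | i <- iota 0 k.+1].
rewrite /lmul_coef -(fsbig_widen [set` r] [set: int])//; last first.
  move=> i /= [_ /negP ir].
  have [/fN->|Ni] := ltP i N; first by rewrite mul0r.
  rewrite gM ?mulr0//; suff : N + k%:Z < i by lia.
  rewrite ltNge; apply: contra ir => ik; apply/mapP.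
  by exists `|i - N|%N; [rewrite mem_iota; lia | lia].
rewrite -fsbig_seq; last first.
  by rewrite map_inj_uniq ?iota_uniq// => i j /addrI [].
rewrite big_map -[iota _ _]/(index_iota 0 k.+1) big_mkord.
apply: eq_bigr => i _.
by congr (_ * g _); have := ltn_ord i; lia.
Qed.

Lemma lmul_coef0 (f g : int -> R) (N M : int) k :
  (forall i, i < N -> f i = 0) -> (forall i, i < M -> g i = 0) ->
  k < N + M -> lmul_coef f g k = 0.
Proof.
move=> fN gM kNM; apply: fsbig1 => i _.
have [/fN->|Ni] := ltP i N; first by rewrite mul0r.
by rewrite gM ?mulr0//; lia.
Qed.

Lemma lmul_subproof f g :
  exists N : int, forall k, k < N -> lmul_coef f g k = 0.
Proof.
have [N fN] := lcoef_bounded f; have [M gM] := lcoef_bounded g.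
by exists (N + M) => k; apply: lmul_coef0.
Qed.

Definition ladd f g := Laurent (ladd_subproof f g).
Definition lopp f := Laurent (lopp_subproof f).
Definition lscale c f := Laurent (lscale_subproof c f).
Definition lmul f g := Laurent (lmul_subproof f g).
Definition lzero := lser (fun=> 0).
Definition lone := lmono 0.

Lemma laddA : associative ladd.
Proof. by move=> f g h; apply: laurentP => k /=; rewrite addrA. Qed.
Lemma laddC : commutative ladd.
Proof. by move=> f g; apply: laurentP => k /=; rewrite addrC. Qed.
Lemma ladd0 : left_id lzero ladd.
Proof. by move=> f; apply: laurentP => k /=; rewrite if_same add0r. Qed.
Lemma laddN : left_inverse lzero lopp ladd.
Proof. by move=> f; apply: laurentP => k /=; rewrite if_same addNr. Qed.

HB.instance Definition _ := GRing.isZmodule.Build laurent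
  laddA laddC ladd0 laddN.

Lemma lcoef0 k : (0 : laurent) k = 0. Proof. exact: if_same. Qed.
Lemma lcoefD f g k : (f + g) k = f k + g k. Proof. by []. Qed.
Lemma lcoefN f k : (- f) k = - f k. Proof. by []. Qed.

Lemma lscaleA a b f : lscale a (lscale b f) = lscale (a * b) f.
Proof. by apply: laurentP => k /=; rewrite mulrA. Qed.
Lemma lscale1 : left_id 1 lscale.
Proof. by move=> f; apply: laurentP => k /=; rewrite mul1r. Qed.
Lemma lscaleDr : right_distributive lscale +%R.
Proof. by move=> a f g; apply: laurentP => k /=; rewrite mulrDr. Qed.
Lemma lscaleDl f : {morph lscale^~ f : a b / a + b}.
Proof. by move=> a b; apply: laurentP => k /=; rewrite mulrDl. Qed.

HB.instance Definition _ := GRing.Zmodule_isLmodule.Build R laurent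
  lscaleA lscale1 lscaleDr lscaleDl.

Lemma lmulC : commutative lmul.
Proof.
move=> f g; apply: laurentP => k /=.
have [N fN] := lcoef_bounded f; have [M gM] := lcoef_bounded g.
have [kNM|NMk] := ltP k (N + M).
  by rewrite (lmul_coef0 fN gM)// (lmul_coef0 gM fN)// addrC.
have -> : k = N + M + (absz (k - (N + M))%R)%:Z by lia.
by rewrite lmul_coefE// [N + M]addrC lmul_coefE// convC.
Qed.

Lemma lmulA : associative lmul.
Proof.
move=> f g h; apply: laurentP => k /=.
have [N fN] := lcoef_bounded f; have [M gM] := lcoef_bounded g.
have [P hP] := lcoef_bounded h.
have fgM i : i < N + M -> lmul_coef f g i = 0 by apply: lmul_coef0.
have ghM i : i < M + P -> lmul_coef g h i = 0 by apply: lmul_coef0.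
have [kNM|NMk] := ltP k (N + M + P).
  by rewrite (lmul_coef0 fN ghM) ?addrA// (lmul_coef0 fgM hP).
have -> : k = N + M + P + (absz (k - (N + M + P))%R)%:Z by lia.
rewrite (lmul_coefE _ fgM hP) -(addrA N) (lmul_coefE _ fN ghM).
rewrite (_ : (fun i : nat => lmul_coef g h _) =
  conv (fun i => g (M + i%:Z)) (fun i => h (P + i%:Z))).
  rewrite convA; congr conv; apply/funext => i.
  by rewrite lmul_coefE.
by apply/funext => i; rewrite lmul_coefE.
Qed.

Lemma lmul1 : left_id lone lmul.
Proof.
move=> f; apply: laurentP => k /=.
rewrite /lmul_coef -(fsbig_widen [set 0] [set: int])//; last first.
  by move=> i /= [_ /eqP/negPf i0]; rewrite i0 if_same mul0r.
by rewrite fsbig_set1 /= mul1r subr0.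
Qed.

Lemma lmulDl : left_distributive lmul +%R.
Proof.
move=> f g h; apply: laurentP => k /=.
have [N0 fN0] := lcoef_bounded f; have [N1 gN1] := lcoef_bounded g.
pose N := Order.min N0 N1.
have fN i : i < N -> f i = 0 by rewrite lt_min => /andP[/fN0].
have gN i : i < N -> g i = 0 by rewrite lt_min => /andP[_ /gN1].
have fgN i : i < N -> f i + g i = 0 by move=> iN; rewrite fN// gN// addr0.
have [M hM] := lcoef_bounded h.
have [kNM|NMk] := ltP k (N + M).
  rewrite (lmul_coef0 fgN hM)// (lmul_coef0 gN hM)// (lmul_coef0 fN hM)//.
  by rewrite addr0.
have -> : k = N + M + (absz (k - (N + M))%R)%:Z by lia.
rewrite !(lmul_coefE _ _ hM)// /conv -big_split; apply: eq_bigr => i _ /=.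
by rewrite mulrDl.
Qed.

HB.instance Definition _ := GRing.Zmodule_isComPzRing.Build laurent
  lmulA lmulC lmul1 lmulDl.

Lemma lscaleAl c f g : c *: (f * g) = (c *: f) * g.
Proof.
apply: laurentP => k; rewrite -[LHS]/(c * lmul_coef f g k).
rewrite -[RHS]/(lmul_coef (fun i => c * f i) g k).
have [N fN] := lcoef_bounded f; have [M gM] := lcoef_bounded g.
have cfN i : i < N -> c * f i = 0 by move=> /fN ->; rewrite mulr0.
have [kNM|NMk] := ltP k (N + M).
  by rewrite (lmul_coef0 fN gM)// (lmul_coef0 cfN gM)// mulr0.
have -> : k = N + M + (absz (k - (N + M))%R)%:Z by lia.
rewrite !lmul_coefE// /conv mulr_sumr; apply: eq_bigr => i _.
by rewrite mulrA.
Qed.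

Lemma lone_neq0 : (1 : laurent) != 0.
Proof.
apply/eqP => /(congr1 (fun f : laurent => f 0)); rewrite lcoef0.
by move/eqP; rewrite oner_eq0.
Qed.

HB.instance Definition _ := GRing.PzSemiRing_isNonZero.Build laurent lone_neq0.

End Laurent.

Section TruncatedPoly.
Variables (n : nat) (R : comNzRingType).

(* R[x]/(x^n), a class being represented by its polynomial of degree < n; for
   n = 0 this is the zero ring. *)
Definition tpoly : Type := {poly_n R}.

HB.instance Definition _ := GRing.Lmodule.on tpoly.

Implicit Types p q r : tpoly.

Definition tmul p q : tpoly := npolyp n (polyn p * polyn q).
Definition tone : tpoly := npolyp n 1.

Lemma polyn_tmul p q : polyn (tmul p q) = take_poly n (polyn p * polyn q).
Proof. by apply/polyP => i; rewrite coef_npolyp coef_take_poly. Qed.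

Lemma take_polyMl (u v : {poly R}) :
  take_poly n (take_poly n u * v) = take_poly n (u * v).
Proof.
rewrite -[in RHS](poly_take_drop n u) mulrDl take_polyD mulrAC take_polyMXn_0.
by rewrite addr0.
Qed.

Lemma take_polyn p : take_poly n (polyn p) = polyn p.
Proof. by rewrite take_poly_id ?size_npoly. Qed.

Lemma tmulC : commutative tmul.
Proof. by move=> p q; apply/val_inj; rewrite /= !polyn_tmul mulrC. Qed.

Lemma tmulA : associative tmul.
Proof.
move=> p q r; apply/val_inj; rewrite /= !polyn_tmul take_polyMl.
by rewrite mulrC take_polyMl mulrC mulrA.
Qed.

Lemma tmul1 : left_id tone tmul.
Proof.
move=> p; apply/val_inj; rewrite /= polyn_tmul.
rewrite (_ : polyn tone = take_poly n 1); last first.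
  by apply/polyP => i; rewrite coef_npolyp coef_take_poly.
by rewrite take_polyMl mul1r take_polyn.
Qed.

Lemma tmulDl : left_distributive tmul +%R.
Proof.
have D (u v : tpoly) : polyn (u + v) = polyn u + polyn v.
  exact: (raddfD (@polyn R n)).
move=> p q r; apply/val_inj.
change (polyn (tmul (p + q) r) = polyn (tmul p r + tmul q r)).
by rewrite D !polyn_tmul D mulrDl take_polyD.
Qed.

HB.instance Definition _ := GRing.Zmodule_isComPzRing.Build tpoly
  tmulA tmulC tmul1 tmulDl.

Lemma tscaleAl c p q : c *: (p * q) = (c *: p) * q.
Proof.
apply/val_inj; have Z u (r : tpoly) : polyn (u *: r) = u *: polyn r by [].
change (polyn (c *: tmul p q) = polyn (tmul (c *: p) q)).
by rewrite Z !polyn_tmul Z -scalerAl take_polyZ.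
Qed.

End TruncatedPoly.

Section Aext.
Variables (n : nat) (R : comNzRingType).

(* R((x)) * R[x]/(x^n): A(n, alpha) is Aext n F, and the rings A_m are obtained
   by iteration, A_m = Aext n A_{m-1}, the outermost variable being x_m. *)
Definition Aext : Type := (laurent R * tpoly n R)%type.

HB.instance Definition _ := GRing.ComPzRing.on Aext.
HB.instance Definition _ := GRing.Lmodule.on Aext.

Lemma Aext_one_neq0 : (1 : Aext) != 0.
Proof.
apply/eqP => /(congr1 fst) E; have := lone_neq0 R.
by rewrite (E : (1 : laurent R) = 0) eqxx.
Qed.

HB.instance Definition _ := GRing.PzSemiRing_isNonZero.Build Aext Aext_one_neq0.

Lemma Aext_scaleAl c (u v : Aext) : c *: (u * v) = (c *: u) * v.
Proof. by congr pair; [exact: lscaleAl|exact: tscaleAl]. Qed.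

HB.instance Definition _ := GRing.Lmodule_isLalgebra.Build R Aext Aext_scaleAl.
HB.instance Definition _ := GRing.Lalgebra_isComAlgebra.Build R Aext.

(* f |-> (f, [f]) on power series, given by their coefficients *)
Definition diag (c : nat -> R) : Aext := (lser c, mk_npoly n c).

End Aext.

Section AextMap.
Variables (n : nat) (R S : comNzRingType) (phi : {additive R -> S}).

Lemma lmap_subproof (f : laurent R) :
  exists N : int, forall k, k < N -> phi (f k) = 0.
Proof.
by have [N fN] := lcoef_bounded f; exists N => k /fN ->; rewrite raddf0.
Qed.

Definition lmap (f : laurent R) : laurent S := Laurent (lmap_subproof f).

Definition Aext_map (u : Aext n R) : Aext n S :=
  (lmap u.1, mk_npoly n (fun l => phi (polyn u.2)`_l)).

End AextMap.

(* The associative unital K-algebra generated by X subject to the relations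
   rel: formal expressions modulo the smallest congruence which contains rel and
   makes the quotient a K-algebra. *)
Section PresentedAlgebra.
Local Open Scope quotient_scope.
Variables (K : comPzRingType) (X : Type).

Inductive pterm : Type :=
| Gen of X
| Cst of K
| Add of pterm & pterm
| Mul of pterm & pterm.

HB.instance Definition _ := gen_eqMixin pterm.
HB.instance Definition _ := gen_choiceMixin pterm.

Variable rel : pterm -> pterm -> Prop.

Inductive cong : pterm -> pterm -> Prop :=
| cong_rel s t : rel s t -> cong s t
| cong_refl t : cong t t
| cong_sym s t : cong s t -> cong t s
| cong_trans s t u : cong s t -> cong t u -> cong s u
| cong_add s s' t t' : cong s s' -> cong t t' -> cong (Add s t) (Add s' t')
| cong_mul s s' t t' : cong s s' -> cong t t' -> cong (Mul s t) (Mul s' t')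
| cong_addA s t u : cong (Add s (Add t u)) (Add (Add s t) u)
| cong_addC s t : cong (Add s t) (Add t s)
| cong_add0 t : cong (Add (Cst 0) t) t
| cong_mulA s t u : cong (Mul s (Mul t u)) (Mul (Mul s t) u)
| cong_mulDl s t u : cong (Mul (Add s t) u) (Add (Mul s u) (Mul t u))
| cong_mulDr s t u : cong (Mul s (Add t u)) (Add (Mul s t) (Mul s u))
| cong_mul0 t : cong (Mul (Cst 0) t) (Cst 0)
| cong_mul1 t : cong (Mul (Cst 1) t) t
| cong_cstD a b : cong (Cst (a + b)) (Add (Cst a) (Cst b))
| cong_cstM a b : cong (Cst (a * b)) (Mul (Cst a) (Cst b))
| cong_cst_central a t : cong (Mul (Cst a) t) (Mul t (Cst a)).

Definition congb s t := `[< cong s t >].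
Lemma congb_refl : reflexive congb.
Proof. by move=> t; apply/asboolP/cong_refl. Qed.
Lemma congb_sym : symmetric congb.
Proof. by move=> s t; apply/asboolP/asboolP => /cong_sym. Qed.
Lemma congb_trans : transitive congb.
Proof.
by move=> t s u /asboolP st /asboolP tu; apply/asboolP/(cong_trans st tu).
Qed.
Canonical cong_equiv := EquivRel congb congb_refl congb_sym congb_trans.

Definition presented : Type := {eq_quot cong_equiv}.
HB.instance Definition _ := Choice.on presented.

Definition pclass (t : pterm) : presented := \pi_{eq_quot cong_equiv} t.
Definition prep (x : presented) : pterm := repr (x : {eq_quot cong_equiv}).

Lemma prepK x : pclass (prep x) = x. Proof. exact: reprK. Qed.
Lemma pclassP s t : pclass s = pclass t <-> cong s t.
Proof. by split=> [/eqmodP/asboolP|st]; last apply/eqmodP/asboolP. Qed.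
Lemma prep_cong t : cong (prep (pclass t)) t.
Proof. by apply/pclassP; rewrite prepK. Qed.

Definition pgen (x : X) := pclass (Gen x).
Definition pcst (a : K) := pclass (Cst a).
Definition padd x y := pclass (Add (prep x) (prep y)).
Definition pmul x y := pclass (Mul (prep x) (prep y)).
Definition popp x := pmul (pcst (-1)) x.

Lemma paddE s t : padd (pclass s) (pclass t) = pclass (Add s t).
Proof. by apply/pclassP; apply: cong_add; apply: prep_cong. Qed.
Lemma pmulE s t : pmul (pclass s) (pclass t) = pclass (Mul s t).
Proof. by apply/pclassP; apply: cong_mul; apply: prep_cong. Qed.

Lemma paddA : associative padd.
Proof.
move=> x y z; rewrite -(prepK x) -(prepK y) -(prepK z) !paddE.
by apply/pclassP; apply: cong_addA.
Qed.
Lemma paddC : commutative padd.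
Proof.
by move=> x y; rewrite -(prepK x) -(prepK y) !paddE; apply/pclassP/cong_addC.
Qed.
Lemma padd0 : left_id (pcst 0) padd.
Proof. by move=> x; rewrite -(prepK x) paddE; apply/pclassP/cong_add0. Qed.
Lemma pmulA : associative pmul.
Proof.
move=> x y z; rewrite -(prepK x) -(prepK y) -(prepK z) !pmulE.
by apply/pclassP; apply: cong_mulA.
Qed.
Lemma pmulDl : left_distributive pmul padd.
Proof.
move=> x y z; rewrite -(prepK x) -(prepK y) -(prepK z) !(pmulE, paddE).
by apply/pclassP; apply: cong_mulDl.
Qed.
Lemma pmulDr : right_distributive pmul padd.
Proof.
move=> x y z; rewrite -(prepK x) -(prepK y) -(prepK z) !(pmulE, paddE).
by apply/pclassP; apply: cong_mulDr.
Qed.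
Lemma pmul1 : left_id (pcst 1) pmul.
Proof. by move=> x; rewrite -(prepK x) pmulE; apply/pclassP/cong_mul1. Qed.
Lemma pcst_central a x : pmul (pcst a) x = pmul x (pcst a).
Proof.
by rewrite -(prepK x) !pmulE; apply/pclassP/cong_cst_central.
Qed.
Lemma pmulr1 : right_id (pcst 1) pmul.
Proof. by move=> x; rewrite -pcst_central pmul1. Qed.
Lemma pcstD a b : pcst (a + b) = padd (pcst a) (pcst b).
Proof. by rewrite paddE; apply/pclassP/cong_cstD. Qed.
Lemma pcstM a b : pcst (a * b) = pmul (pcst a) (pcst b).
Proof. by rewrite pmulE; apply/pclassP/cong_cstM. Qed.
Lemma pmul0 x : pmul (pcst 0) x = pcst 0.
Proof. by rewrite -(prepK x) pmulE; apply/pclassP/cong_mul0. Qed.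
Lemma paddN : left_inverse (pcst 0) popp padd.
Proof. by move=> x; rewrite -{2}[x]pmul1 -pmulDl -pcstD addNr pmul0. Qed.

HB.instance Definition _ := GRing.isZmodule.Build presented
  paddA paddC padd0 paddN.
HB.instance Definition _ := GRing.Zmodule_isPzRing.Build presented
  pmulA pmul1 pmulr1 pmulDl pmulDr.

Lemma pclassD s t : pclass (Add s t) = pclass s + pclass t.
Proof. by rewrite -[RHS]/(padd _ _) paddE. Qed.
Lemma pclassM s t : pclass (Mul s t) = pclass s * pclass t.
Proof. by rewrite -[RHS]/(pmul _ _) pmulE. Qed.
Lemma pclass_rel s t : rel s t -> pclass s = pclass t.
Proof. by move=> st; apply/pclassP/cong_rel. Qed.

Fact pcst_additive : zmod_morphism pcst.
Proof.
move=> a b; rewrite pcstD -[LHS]/(pcst a + pcst (- b)) -mulN1r pcstM.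
by [].
Qed.
Fact pcst_multiplicative : monoid_morphism pcst.
Proof. by split=> // a b; rewrite pcstM. Qed.
HB.instance Definition _ := GRing.isZmodMorphism.Build K presented pcst
  pcst_additive.
HB.instance Definition _ := GRing.isMonoidMorphism.Build K presented pcst
  pcst_multiplicative.

End PresentedAlgebra.

Section Enveloping.
Variables (F : fieldType) (g : lmodType F) (br : g -> g -> g).

(* The universal enveloping algebra U(g). *)
Inductive uea_rel : pterm F g -> pterm F g -> Prop :=
| uea_linear c x y :
    uea_rel (Gen F (c *: x + y)) (Add (Mul (Cst g c) (Gen F x)) (Gen F y))
| uea_bracket x y :
    uea_rel (Add (Gen F (br x y)) (Mul (Gen F y) (Gen F x)))
            (Mul (Gen F x) (Gen F y)).

Definition uea : pzRingType := presented uea_rel.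
Definition uea_cst : {rmorphism F -> uea} := pcst uea_rel.
Definition uea_gen (x : g) : uea := pgen uea_rel x.

Lemma uea_genP c x y : uea_gen (c *: x + y) = uea_cst c * uea_gen x + uea_gen y.
Proof. by have := pclass_rel (uea_linear c x y); rewrite pclassD pclassM. Qed.
Lemma uea_gen_bracket x y :
  uea_gen (br x y) = uea_gen x * uea_gen y - uea_gen y * uea_gen x.
Proof.
apply/(canRL (addrK _)).
by have := pclass_rel (uea_bracket x y); rewrite pclassD !pclassM.
Qed.
End Enveloping.

Section Tensor.
Variables (F : fieldType) (A B : pzRingType).
Variables (iA : {rmorphism F -> A}) (iB : {rmorphism F -> B}).

Let T := pterm F (A * B).
Let tn (a : A) (b : B) : T := Gen F (a, b).

(* The tensor product over F of two F-algebras, given by rings A and B with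
   (central) structure morphisms iA and iB; Gen (a, b) is the pure tensor. *)
Inductive tensor_rel : T -> T -> Prop :=
| tensor_addl a a' b : tensor_rel (tn (a + a') b) (Add (tn a b) (tn a' b))
| tensor_addr a b b' : tensor_rel (tn a (b + b')) (Add (tn a b) (tn a b'))
| tensor_scalel c a b : tensor_rel (tn (iA c * a) b) (Mul (Cst _ c) (tn a b))
| tensor_scaler c a b : tensor_rel (tn a (iB c * b)) (Mul (Cst _ c) (tn a b))
| tensor_mul a a' b b' :
    tensor_rel (tn (a * a') (b * b')) (Mul (tn a b) (tn a' b'))
| tensor_one : tensor_rel (tn 1 1) (Cst _ 1).

Definition tensor_alg : pzRingType := presented tensor_rel.
Definition tensor_cst : {rmorphism F -> tensor_alg} := pcst tensor_rel.
Definition tensor (a : A) (b : B) : tensor_alg := pgen tensor_rel (a, b).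

Lemma tensorDl a a' b : tensor (a + a') b = tensor a b + tensor a' b.
Proof. by have := pclass_rel (tensor_addl a a' b); rewrite pclassD. Qed.
Lemma tensorDr a b b' : tensor a (b + b') = tensor a b + tensor a b'.
Proof. by have := pclass_rel (tensor_addr a b b'); rewrite pclassD. Qed.
Lemma tensorZl c a b : tensor (iA c * a) b = tensor_cst c * tensor a b.
Proof. by have := pclass_rel (tensor_scalel c a b); rewrite pclassM. Qed.
Lemma tensorZr c a b : tensor a (iB c * b) = tensor_cst c * tensor a b.
Proof. by have := pclass_rel (tensor_scaler c a b); rewrite pclassM. Qed.
Lemma tensorM a a' b b' : tensor (a * a') (b * b') = tensor a b * tensor a' b'.
Proof. by have := pclass_rel (tensor_mul a a' b b'); rewrite pclassM. Qed.
Lemma tensor11 : tensor 1 1 = 1.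
Proof. exact: pclass_rel tensor_one. Qed.
End Tensor.

Section LieAlgebra.
Variables (F : fieldType) (g : vectType F).
Implicit Types (br : g -> g -> g) (I : {vspace g}).

Record lie_bracket br : Prop := LieBracket {
  lie_linearl : forall y, linear (br^~ y);
  lie_linearr : forall x, linear (br x);
  lie_alternating : forall x, br x x = 0;
  lie_jacobi : forall x y z, br x (br y z) + br y (br z x) + br z (br x y) = 0 }.

Definition lie_ideal br I := forall x y, y \in I -> br x y \in I.

Definition lie_simple br :=
  (exists x y, br x y != 0) /\
  (forall I, lie_ideal br I -> I = 0%VS \/ I = fullv).

Definition killing br (x y : g) : F :=
  \tr (passmx.mxof (vbasis fullv) (vbasis fullv)
    (linfun (br x) \o linfun (br y))%VF).

Definition orthonormal_basis br d (b : d.-tuple g) :=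
  basis_of fullv b /\
  forall i j : 'I_d, killing br (tnth b i) (tnth b j) = (i == j)%:R.

End LieAlgebra.

Section Functional.
Variables (F : fieldType) (n : nat) (al : int -> F).

(* x^-n + al (n-2) x^(-n+1) + ... + al 0 x^-1 + ...: the coefficient of x^(-i-1)
   is al i for i <= n - 2, and only these values of al are used. *)
Definition alpha : laurent F :=
  lfrom (- n%:Z) (fun k => if k == - n%:Z then 1 else al (- k - 1)).

Definition t1 (u : Aext n F) : F :=
  res (alpha * (u.1 - lser (fun k => (polyn u.2)`_k))).

(* From the functional t on A_{m-1} to the one on A_m; the first sum has finite
   support since t1 (x^k, 0) = 0 for k >= n. *)
Definition tnext (R : comNzRingType) (t : R -> F) (u : Aext n R) : F :=
  \sum_(k \in [set: int]) t (u.1 k) * t1 (lmono F k, 0)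
  + \sum_(l < n) t (polyn u.2)`_l * t1 (0, npolyp n 'X^l).

Definition t2 : Aext n (Aext n F) -> F := tnext t1.
Definition t3 : Aext n (Aext n (Aext n F)) -> F := tnext t2.

End Functional.

Section SubspacesOf.
Variables (F : fieldType) (V : lmodType F).
Implicit Types U W : set V.

Definition subspace U := U 0 /\ forall c u v, U u -> U v -> U (c *: u + v).

Definition direct_sum U W :=
  (forall v, exists u w, [/\ U u, W w & v = u + w]) /\
  (forall v, U v -> W v -> v = 0).

End SubspacesOf.

Section Division.
Variable R : zmodType.

(* Doubly indexed families are the coefficients of series in x, y (k for x, l for
   y). If u(x, x) = 0 then divxy u is the quotient u(x, y) / (x - y). *)
Definition divxy (u : nat -> nat -> R) (k l : nat) : R :=
  \sum_(j < l.+1) u (k + j).+1 (l - j)%N.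

Lemma divxyP (u : nat -> nat -> R) :
  (forall l, \sum_(j < l.+1) u j (l - j)%N = 0) ->
  forall k l,
  (if k is k'.+1 then divxy u k' l else 0)
  - (if l is l'.+1 then divxy u k l' else 0) = u k l.
Proof.
move=> u0 k l.
have E : \sum_(j < l.+1) u (k + j)%N (l - j)%N
    = u k l + (if l is l'.+1 then divxy u k l' else 0).
  rewrite big_ord_recl /= addn0 subn0; congr (_ + _).
  case: l => [|l]; first by rewrite big_ord0.
  by apply: eq_bigr => j _; rewrite /bump /= add1n subSS addnS.
apply/(canLR (addrK _)); rewrite -E.
case: k {E} => [|k]; first by rewrite -[LHS](u0 l).
by apply: eq_bigr => j _; rewrite addSn.
Qed.

End Division.

Section ManinSeries.
Variables (F : fieldType) (g : vectType F) (br : g -> g -> g).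
Variables (d : nat) (b : d.-tuple g) (n : nat) (al : int -> F).

Local Notation A1 := (Aext n F).
Local Notation A2 := (Aext n A1).
Local Notation A3 := (Aext n A2).
Local Notation kappa i j := (killing br (tnth b i) (tnth b j)).

(* g (x) A(n, alpha), where v stands for \sum_i b_i (x) v i *)
Definition Lalg : lmodType F := {ffun 'I_d -> A1}.

Implicit Types u v : Lalg.

(* the pure tensor a (x) f *)
Definition pure (a : g) (f : A1) : Lalg := [ffun i => coord b i a *: f].

Definition Lbr u v : Lalg :=
  \sum_i \sum_j pure (br (tnth b i) (tnth b j)) (u i * v j).

Definition LB u v : F := \sum_i \sum_j kappa i j * t1 al (u i * v j).

(* the action of the power series with coefficients s *)
Definition Lact (s : nat -> F) v : Lalg := [ffun i => diag n s * v i].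

(* (f, [f]) for the element f = \sum_i b_i (x) \sum_k f k i x^k of g[[x]] *)
Definition Ldiag (f : nat -> 'I_d -> F) : Lalg :=
  [ffun i => diag n (fun k => f k i)].

Definition Delta : set Lalg := range Ldiag.

(* (L (x) g)[[y]], where r stands for \sum_(k, i) r k i (x) b_i y^k *)
Definition series := nat -> 'I_d -> Lalg.

(* (g (x) g)[[x, y]]: h k l p q is the coefficient of (b_p (x) b_q) x^k y^l *)
Definition gg_series := nat -> nat -> 'M[F]_d.

(* y^n Omega / (x - y) *)
Definition w : series := fun k i =>
  pure (tnth b i)
    (if (k < n)%N then (0, - npolyp n 'X^(n.-1 - k))
     else (lmono F (n%:Z - 1 - k%:Z), 0)).

(* s(x) y^n Omega / (x - y) + h(x, y) *)
Definition mk_series (s : nat -> F) (h : gg_series) : series := fun l q =>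
  Lact s (w l q) + Ldiag (fun k p => h k l p q).

Definition type_series (s : nat -> F) : set series := range (mk_series s).

(* s(x) y^n - s(y) x^n *)
Definition swap_num (s : nat -> F) (k l : nat) : F :=
  s k * (l == n)%:R - s l * (k == n)%:R.

Lemma swap_num_diag s l : \sum_(j < l.+1) swap_num s j (l - j)%N = 0.
Proof.
rewrite sumrB; apply/eqP; rewrite subr_eq0; apply/eqP.
rewrite [RHS](reindex_inj rev_ord_inj) /=.
by apply: eq_bigr => j _; rewrite subSS subKn// -ltnS.
Qed.

(* If r = mk_series s h then mk_series s (bar s h) is the series
   s(y) x^n Omega / (x - y) - tau (h(y, x)); b being orthonormal, Omega has
   coefficient matrix 1. *)
Definition bar (s : nat -> F) (h : gg_series) : gg_series := fun k l =>
  - (divxy (swap_num s) k l)%:M - (h l k)^T.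

Definition W (r : series) : set Lalg :=
  [set v | exists (N : nat) (c : nat -> 'I_d -> F),
     v = \sum_(k < N) \sum_(i < d) c k i *: r k i].

Definition Lorthog (V : set Lalg) : set Lalg :=
  [set v | forall u, V u -> LB v u = 0].

Definition U : pzRingType := uea br.
Definition F_A3 : {rmorphism F -> A3} :=
  (in_alg A3 \o (in_alg A2 \o in_alg A1)).
Definition UU_cst := tensor_cst (uea_cst br) (uea_cst br).
Definition UUU_cst := tensor_cst UU_cst (uea_cst br).

(* U(g) (x) U(g) (x) U(g) (x) A_3 *)
Definition U3A : pzRingType := tensor_alg UUU_cst F_A3.

Definition pure3 (x y z : U) (f : A3) : U3A :=
  tensor UUU_cst F_A3 (tensor UU_cst (uea_cst br)
    (tensor (uea_cst br) (uea_cst br) x y) z) f.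

Local Notation iota i := (uea_gen br (tnth b i)).

(* f(x_1), f(x_2) and f(x_3) in A_3 for f in A(n, alpha) *)
Definition var1 (f : A1) : A3 := in_alg A3 (in_alg A2 f).
Definition var2 (f : A1) : A3 := in_alg A3 (Aext_map (in_alg A1) f).
Definition var3 (f : A1) : A3 := Aext_map (in_alg A2 \o in_alg A1) f.

Definition r12 (r : series) : U3A :=
  \sum_p \sum_q pure3 (iota p) (iota q) 1
    (in_alg A3 (diag n (fun k => r k q p))).
Definition r13 (r : series) : U3A :=
  \sum_p \sum_q pure3 (iota p) 1 (iota q)
    (diag n (fun k => in_alg A2 (r k q p))).
Definition r23 (r : series) : U3A :=
  \sum_p \sum_q pure3 1 (iota p) (iota q)
    (diag n (fun k => Aext_map (in_alg A1) (r k q p))).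

Definition comm (x y : U3A) : U3A := x * y - y * x.

Definition GCYB (r rbar : series) : U3A :=
  comm (r12 r) (r13 r) + comm (r12 r) (r23 r) + comm (r13 r) (r23 rbar).

(* g (x) g (x) g (x) A_3, in the basis b_p (x) b_q (x) b_r *)
Definition g3A := 'I_d -> 'I_d -> 'I_d -> A3.

(* (g (x) g (x) g)[[x_1, x_2, x_3]]: psi p q r k1 k2 k3 is the coefficient of
   b_p x_1^k1 (x) b_q x_2^k2 (x) b_r x_3^k3 *)
Definition ggg_series := 'I_d -> 'I_d -> 'I_d -> nat -> nat -> nat -> F.

Definition ggg_diag (psi : ggg_series) : g3A := fun p q r =>
  diag n (fun k3 => diag n (fun k2 => diag n (fun k1 => psi p q r k1 k2 k3))).

Definition g3A_U3A (T : g3A) : U3A :=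
  \sum_p \sum_q \sum_r pure3 (iota p) (iota q) (iota r) (T p q r).

Definition tensor3 (v1 v2 v3 : Lalg) : g3A := fun p q r =>
  var1 (v1 p) * var2 (v2 q) * var3 (v3 r).

Definition B3 (S T : g3A) : F :=
  \sum_p \sum_q \sum_r \sum_p' \sum_q' \sum_r'
    t3 al (S p q r * T p' q' r') * (kappa p p' * kappa q q' * kappa r r').

Definition defines_psi (r rbar : series) (psi : ggg_series) : Prop :=
  forall v1 v2 v3, W rbar v1 -> W r v2 -> W r v3 ->
  B3 (tensor3 v1 v2 v3) (ggg_diag psi) = LB v1 (Lbr v2 v3).

End ManinSeries.

Arguments type_series {F g d} b n s.
Arguments mk_series {F g d} b n s h.
Arguments bar {F d} n s h.
Arguments Delta {F d n}.
Arguments W {F d n} r.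

(* Main.v *)
From HB Require Import structures.
Require Import Defs.
From mathcomp Require Import all_boot all_order all_algebra.
From mathcomp Require Import zify ring.
From mathcomp Require Import boolp classical_sets functions fsbigop.

Set Implicit Arguments.
Unset Strict Implicit.
Unset Printing Implicit Defensive.

Import Order.TTheory GRing.Theory Num.Theory.

Local Open Scope classical_set_scope.
Local Open Scope ring_scope.

(** Everything rests on one duality.  Write t for the residue functional,
    B for the form it induces on L, and w_k for the coefficients of
    y^n Omega / (x - y).  The diagonal is isotropic, since t only sees the
    difference f - p of the two components of an element (f, [p]) and this
    difference is divisible by x^n on the diagonal, while x^n alpha(x) is a power
    series.  Moreover s(x) x^n alpha(x) = 1 gives t (x^k s w_l) = delta_kl
    ([tres_diag_swcoef]), and an element orthogonal to all x^k is diagonal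
    ([tres_xdiag0_diag]).  Hence for every series r of type (n, s) the r_(k,i)
    are dual to the b_i x^k, and each v in L is uniquely a diagonal element plus
    the finite sum of the B(b_i x^k, v) r_(k,i) ([series_decomp]).

    Part 1 follows at once: W(r) is a complement of the diagonal, its unique
    family dual to the b_i x^k has r as generating series, and conversely a
    complement V contains exactly one element of each s w_(k,i) + Delta.

    For part 2 the products t (s w_l s w_m) are computed explicitly; they are the
    coefficients of (s(x) y^n - s(y) x^n) / (x - y) ([t1_swcoef_swcoef]), which is
    the correction term in the definition of rbar.  So W(r) and W(rbar) are
    orthogonal ([LB_series_bar]), and as both are complements of the diagonal,
    each is the full orthogonal of the other.

    For part 3, psi is forced: testing the defining equation on the generators
    r_(k,i) shows that its coefficients are B(rbar_(k1,p), [r_(k2,q), r_(k3,e)]),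
    and trilinearity shows that this psi works ([gcyb_psi_unique]).  Expanding the
    commutators in the enveloping algebras ([comm_T12_T13] and its companions)
    turns GCYB(r) = psi into an identity between families of elements of A_3.
    All terms are power series in x_3, so it can be checked on the coefficients of
    x_3^k3, that is in g (x) g (x) A_2 ([gcyb_coef]).  There the pairing in the
    second variable is non-degenerate, and L is the sum of the diagonal and W(r).
    Pairing with b_q x^m leaves only two terms, which cancel because the
    structure constants in an orthonormal basis are totally antisymmetric.  Pairing
    with v = r_(m,e0) kills [r13, rbar23], by part 2; the term [r12, r13] gives
    [v, r_(k3,e)], the term [r12, r23] minus the projection of this element to W(r)
    along the diagonal, and psi its projection to the diagonal along W(r).

    Residues are taken over an arbitrary coefficient ring, because the same
    duality is needed for L over F and, in the last step, over A_1. *)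

(** * Laurent series and residues *)

Section LaurentFacts.
Variable R : comNzRingType.
Implicit Types (f g : laurent R) (c : nat -> R).

(** Membership in x^N R[[x]]. *)
Definition ordge (N : int) f := forall k, k < N -> f k = 0.

Lemma ordgeM N M f g : ordge N f -> ordge M g -> ordge (N + M) (f * g).
Proof. by move=> fN gM k; exact: lmul_coef0. Qed.

Lemma lmonoM a f k : (lmono R a * f) k = f (k - a).
Proof.
rewrite -[LHS]/(lmul_coef (lmono R a) f k) /lmul_coef.
rewrite -(fsbig_widen [set a] [set: int])//; last first.
  by move=> i /= [_ /eqP/negPf ia]; rewrite ia if_same mul0r.
by rewrite fsbig_set1 /= ltxx eqxx mul1r.
Qed.

Lemma lmono_lmono a a' : lmono R a * lmono R a' = lmono R (a + a').
Proof.
apply: laurentP => k; rewrite lmonoM /=.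
case: ltP => h; case: ltP => h' //; try lia.
by congr (_ *+ nat_of_bool _); lia.
Qed.

Lemma lserE c k : lser c k = if k < 0 then 0 else c `|k|%N. Proof. by []. Qed.

Lemma lser_delta j : lser (fun k => (k == j)%:R) = lmono R j%:Z.
Proof.
apply: laurentP => k /=.
case: ltP => k0; case: ltP => kj //; try lia.
  by rewrite -[0]/(1 *+ false); congr (_ *+ nat_of_bool _); lia.
by congr (_ *+ nat_of_bool _); lia.
Qed.

Lemma lserM c c' : lser c * lser c' = lser (conv c c').
Proof.
apply: laurentP => k; rewrite lserE; case: ltP => k0.
  by apply: (@ordgeM 0 0) => // i i0; rewrite lserE i0.
rewrite -[LHS]/(lmul_coef (lser c) (lser c') k).
have {1}-> : k = 0 + 0 + `|k|%N%:Z by lia.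
by rewrite lmul_coefE => [|i|i]; rewrite ?lserE ?add0r // => ->.
Qed.

Lemma lser_ord c : ordge 0 (lser c). Proof. by move=> k k0; rewrite lserE k0. Qed.

Lemma ordge0P f : ordge 0 f -> f = lser (fun k => f k%:Z).
Proof.
move=> f0; apply: laurentP => k; rewrite lserE; case: ltP => [/f0//|k0].
by congr (f _); lia.
Qed.

Lemma res_ord0 f : ordge 0 f -> res f = 0. Proof. by apply. Qed.

(** Only the first N coefficients of a power series matter for its residue
    against a series with a pole of order at most N. *)
Lemma res_lserM c f (N : nat) : ordge (- N%:Z) f ->
  res (lser c * f) = \sum_(k < N) c k * f (- 1 - k%:Z).
Proof.
case: N => [|m] fN.
  by rewrite big_ord0; apply: (@ordgeM 0 0) => //; exact: lser_ord.
rewrite /res -[LHS]/(lmul_coef (lser c) f (-1)).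
have -> : (-1)%R = (0 + (- m.+1%:Z) + m%:Z)%R :> int by lia.
rewrite lmul_coefE//; last exact: lser_ord.
apply: eq_bigr => k _; rewrite lserE add0r /=; congr (_ * f _).
by have := ltn_ord k; lia.
Qed.

End LaurentFacts.

(** * The residue functional over a coefficient ring *)

Section RelativeResidue.
Variables (n : nat) (R : comNzRingType).
Implicit Types (u v : Aext n R) (p q : tpoly n R) (c : nat -> R).

Definition tser p : laurent R := lser (fun k => (polyn p)`_k).

Definition trunc c : tpoly n R := mk_npoly n c.

(** The residue functional depends on (f, [p]) only through f - p, where p is
    the representative of degree less than n; and it only matters modulo x^n. *)
Definition gap u : laurent R := u.1 - tser u.2.

Lemma gapD u v : gap (u + v) = gap u + gap v.
Proof.
rewrite /gap -[(u + v).1]/(u.1 + v.1) -[(u + v).2]/(u.2 + v.2).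
have -> : tser (u.2 + v.2) = tser u.2 + tser v.2; last by ring.
apply: laurentP => k; rewrite lcoefD !lserE; case: ltP => _; last exact: coefD.
by rewrite addr0.
Qed.

Lemma gapZ (a : R) u : gap (a *: u) = a *: gap u.
Proof.
rewrite /gap scalerBr -[(a *: u).1]/(a *: u.1) -[(a *: u).2]/(a *: u.2).
congr (_ - _).
apply: laurentP => k; rewrite /= -[RHS]/(a * _) /=.
by case: ltP => _; [rewrite mulr0|exact: coefZ].
Qed.

Lemma tcoefM p q k : (k < n)%N ->
  (polyn (p * q))`_k = conv (fun i => (polyn p)`_i) (fun i => (polyn q)`_i) k.
Proof.
by move=> kn; rewrite -[p * q]/(tmul p q) polyn_tmul coef_take_poly kn coefM.
Qed.

Lemma tcoef_mk c k : (polyn (trunc c))`_k = if (k < n)%N then c k else 0.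
Proof. exact: coef_poly. Qed.

Lemma tcoef_ge p k : (n <= k)%N -> (polyn p)`_k = 0.
Proof. exact: big_coef_npoly. Qed.

Lemma conv_eq c1 c2 c1' c2' k :
  (forall i, (i <= k)%N -> c1 i = c1' i) -> (forall i, (i <= k)%N -> c2 i = c2' i) ->
  conv c1 c2 k = conv c1' c2' k.
Proof.
move=> E1 E2; apply: eq_bigr => i _.
by rewrite E1 1?E2 ?leq_subr// -ltnS.
Qed.

Lemma tser_mulP p q : ordge n%:Z (tser (p * q) - tser p * tser q).
Proof.
move=> k kn; rewrite lserM lcoefD lcoefN !lserE; case: ltP => k0.
  by rewrite subr0.
by rewrite tcoefM ?subrr//; lia.
Qed.

Lemma tser_mkP c : ordge n%:Z (tser (trunc c) - lser c).
Proof.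
move=> k kn; rewrite lcoefD lcoefN !lserE; case: ltP => k0.
  by rewrite subr0.
by rewrite tcoef_mk ifT ?subrr//; lia.
Qed.

Lemma ordgeD N (f f' : laurent R) : ordge N f -> ordge N f' -> ordge N (f + f').
Proof. by move=> fN fN' k kN; rewrite lcoefD fN ?fN'// addr0. Qed.

Lemma ordgeN N (f : laurent R) : ordge N f -> ordge N (- f).
Proof. by move=> fN k kN; rewrite lcoefN fN// oppr0. Qed.

(** Truncating a product changes it by a multiple of x^n, so up to such
    multiples taking the gap commutes with the action of power series. *)
Lemma gap_diagM c u : ordge n%:Z (gap (diag n c * u) - lser c * gap u).
Proof.
have -> : gap (diag n c * u) - lser c * gap u =
    - ((tser (trunc c * u.2) - tser (trunc c) * tser u.2)
       + (tser (trunc c) - lser c) * tser u.2).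
  rewrite /gap -[(diag n c * u).1]/(lser c * u.1).
  rewrite -[(diag n c * u).2]/(trunc c * u.2).
  ring.
apply/ordgeN/ordgeD; first exact: tser_mulP.
rewrite -[n%:Z]addr0; apply: ordgeM; first exact: tser_mkP.
exact: lser_ord.
Qed.

Variables (a : laurent R) (s : nat -> R).
Hypothesis aP : ordge (- n%:Z) a.
Hypothesis sP : lser s * (lmono R n%:Z * a) = 1.

(** For R = F and a = alpha this is the functional t on A(n, alpha); here it
    takes values in the coefficient ring. *)
Definition tres u : R := res (a * gap u).

Lemma res_mulD (f f' g : laurent R) : res (g * (f + f')) = res (g * f) + res (g * f').
Proof. by rewrite mulrDr. Qed.

Lemma tresD u v : tres (u + v) = tres u + tres v.
Proof. by rewrite /tres gapD mulrDr. Qed.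

Lemma tresZ (x : R) u : tres (x *: u) = x * tres u.
Proof. by rewrite /tres gapZ mulrC -lscaleAl mulrC. Qed.

Lemma tres0 : tres 0 = 0.
Proof. by rewrite -(scale0r (0 : Aext n R)) tresZ mul0r. Qed.

(** a has a pole of order at most n, so multiples of x^n do not contribute. *)
Lemma tres_eq u f : ordge n%:Z (gap u - f) -> tres u = res (a * f).
Proof.
move=> uf; rewrite /tres -[gap u](subrK f) res_mulD.
by rewrite [X in X + _]res_ord0 ?add0r// -[0](addNr n%:Z); exact: ordgeM.
Qed.

Lemma tres_diagM c u : tres (diag n c * u) = res (lser c * (a * gap u)).
Proof. by rewrite (tres_eq (@gap_diagM c u)) mulrCA. Qed.

(** The diagonal element (x^k, [x]^k). *)
Definition xdiag k : Aext n R := diag n (fun j => (j == k)%:R).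

Lemma tres_xdiag k u : tres (xdiag k * u) = (a * gap u) (- 1 - k%:Z).
Proof. by rewrite tres_diagM lser_delta /res lmonoM. Qed.

(** Termwise evaluation against a power series is a finite sum, because a times the
    gap of u has a pole of finite order. *)
Lemma tres_diagE u : exists N, forall m, (N <= m)%N ->
  tres (xdiag m * u) = 0 /\
  forall c, tres (diag n c * u) = \sum_(k < m) c k * tres (xdiag k * u).
Proof.
have [M uM] := lcoef_bounded (a * gap u); exists `|M|%N => m Mm; split.
  by rewrite tres_xdiag uM//; lia.
move=> c; rewrite tres_diagM (@res_lserM _ _ _ m) => [|k km].
  by apply: eq_bigr => k _; rewrite tres_xdiag.
by rewrite uM//; lia.
Qed.

(** If f and p agree modulo x^n then f has no pole and p is its truncation. *)
Lemma diagP u : ordge n%:Z (gap u) -> exists c, u = diag n c.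
Proof.
move=> un; exists (fun k => u.1 k%:Z).
have gapE k : k < n%:Z -> u.1 k = tser u.2 k.
  by move=> kn; apply/eqP; rewrite -subr_eq0; apply/eqP/un.
case: u un gapE => f p un /= gapE; congr pair.
  by apply: ordge0P => k k0; rewrite gapE ?lserE ?k0//; lia.
apply/npolyP => k; rewrite [in RHS]tcoef_mk; case: ltnP => kn; last exact: tcoef_ge.
by rewrite gapE ?lserE//; lia.
Qed.

(** The residues of x^k u are the polar coefficients of a times the gap of u; if
    they all vanish, dividing by the unit x^n a shows that the gap is divisible
    by x^n. *)
Lemma tres_xdiag0_diag u : (forall k, tres (xdiag k * u) = 0) -> exists c, u = diag n c.
Proof.
move=> u0; apply: diagP.
have /ordge0P au : ordge 0 (a * gap u).
  move=> k k0; rewrite -[RHS](u0 `|(-1 - k)%R|%N) tres_xdiag.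
  by congr (lcoef _ _); lia.
have -> : gap u = lmono R n%:Z * (lser s * (a * gap u)).
  by rewrite -[LHS]mul1r -sP; ring.
rewrite au lserM -[X in ordge X]addr0; apply: ordgeM; last exact: lser_ord.
by move=> k kn /=; rewrite kn.
Qed.

Lemma gap_diag c : ordge n%:Z (gap (diag n c)).
Proof.
rewrite -[X in ordge _ X]opprK; apply: ordgeN; rewrite opprB.
exact: tser_mkP.
Qed.

Lemma tres_diag c : tres (diag n c) = 0.
Proof.
by rewrite (@tres_eq _ 0) ?mulr0 ?lcoef0// ?subr0; exact: gap_diag.
Qed.

Lemma diagM c c' : diag n c * diag n c' = diag n (conv c c').
Proof.
congr pair; first exact: lserM.
apply/npolyP => k; case: (ltnP k n) => kn; last first.
  by rewrite [RHS]tcoef_ge ?[LHS]tcoef_ge.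
rewrite [RHS]tcoef_mk [LHS](@tcoefM (trunc c) (trunc c'))// kn.
by apply: conv_eq => i ik; rewrite tcoef_mk ifT// (leq_ltn_trans ik).
Qed.

Lemma diagD c c' : diag n (fun k => c k + c' k) = diag n c + diag n c'.
Proof.
congr pair; first by apply: laurentP => k; rewrite lcoefD !lserE; case: ifP;
  rewrite ?addr0.
apply/npolyP => k; rewrite [RHS]coefD !tcoef_mk; case: ifP => //.
by rewrite addr0.
Qed.

Lemma diagZ (x : R) c : diag n (fun k => x * c k) = x *: diag n c.
Proof.
congr pair.
  by apply: laurentP => k; rewrite -[RHS]/(x * lser c k) !lserE; case: ifP;
    rewrite ?mulr0.
apply/npolyP => k; rewrite [RHS]coefZ !tcoef_mk; case: ifP => //.
by rewrite mulr0.
Qed.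

Lemma diag0 : diag n (fun=> 0 : R) = 0.
Proof.
rewrite -[RHS](scale0r (diag n (fun=> 0))) -diagZ; congr diag.
by apply/funext => k; rewrite mul0r.
Qed.

Lemma diagB c c' : diag n (fun k => c k - c' k) = diag n c - diag n c'.
Proof.
rewrite -[- diag n c']scaleN1r -diagZ -diagD; congr diag.
by apply/funext => k; rewrite mulN1r.
Qed.

Definition tX k : tpoly n R := npolyp n 'X^k.

(** The scalar part of the coefficient of y^k in y^n Omega / (x - y). *)
Definition wcoef k : Aext n R :=
  if (k < n)%N then (0, - tX (n.-1 - k)) else (lmono R (n%:Z - 1 - k%:Z), 0).

Lemma tcoefN p k : (polyn (- p))`_k = - (polyn p)`_k. Proof. exact: coefN. Qed.

Lemma tser0 : tser 0 = 0.
Proof. by apply: laurentP => k; rewrite lcoef0 lserE coef0 if_same. Qed.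

Lemma tserN p : tser (- p) = - tser p.
Proof.
by apply: laurentP => k; rewrite lcoefN !lserE tcoefN; case: ifP; rewrite ?oppr0.
Qed.

Lemma tserX k : (k < n)%N -> tser (tX k) = lmono R k%:Z.
Proof.
move=> kn; rewrite -lser_delta; congr lser; apply/funext => j.
rewrite coef_npolyp coefXn; case: ltnP => // nj.
by case: eqP => // jk; lia.
Qed.

(** Both cases of the definition have the same gap; this is what makes the
    w_k behave uniformly under residues. *)
Lemma gap_wcoef k : gap (wcoef k) = lmono R (n%:Z - 1 - k%:Z).
Proof.
rewrite /wcoef /gap; case: ltnP => kn /=; last by rewrite tser0 subr0.
by rewrite tserN opprK add0r tserX; [congr lmono|]; lia.
Qed.

Lemma gap_diagM2 c c' u :
  ordge n%:Z (gap (diag n c * (diag n c' * u)) - lser c * lser c' * gap u).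
Proof.
have -> : gap (diag n c * (diag n c' * u)) - lser c * lser c' * gap u =
    (gap (diag n c * (diag n c' * u)) - lser c * gap (diag n c' * u))
    + lser c * (gap (diag n c' * u) - lser c' * gap u) by ring.
apply: ordgeD; first exact: gap_diagM.
by rewrite -[n%:Z]add0r; apply: ordgeM; [exact: lser_ord|exact: gap_diagM].
Qed.

(** Multiplication by s cancels x^n a and leaves a bare residue. *)
Lemma tres_s c u (m : int) : ordge n%:Z (gap u - lmono R (n%:Z + m)) ->
  tres (diag n c * (diag n s * u)) = lser c (- 1 - m).
Proof.
move=> um; rewrite (@tres_eq _ (lser c * lser s * lmono R (n%:Z + m))); last first.
  have -> : gap (diag n c * (diag n s * u)) - lser c * lser s * lmono R (n%:Z + m) =
    (gap (diag n c * (diag n s * u)) - lser c * lser s * gap u)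
    + lser c * lser s * (gap u - lmono R (n%:Z + m)) by ring.
  apply: ordgeD; first exact: gap_diagM2.
  by rewrite -[n%:Z]add0r lserM; apply: ordgeM um; exact: lser_ord.
rewrite -lmono_lmono.
have -> : a * (lser c * lser s * (lmono R n%:Z * lmono R m)) =
  lser s * (lmono R n%:Z * a) * (lmono R m * lser c) by ring.
by rewrite sP mul1r /res lmonoM.
Qed.

(** The s w_k form the family dual to the x^k. *)
Lemma tres_diag_swcoef c k : tres (diag n c * (diag n s * wcoef k)) = c k.
Proof.
rewrite (@tres_s _ _ (- 1 - k%:Z)); first by rewrite opprB addrCA subrr addr0.
by rewrite gap_wcoef addrA subrr => i _; rewrite lcoef0.
Qed.

(** The product of w_l and w_m vanishes unless both lie in the same factor of
    the ring, and the two factors contribute with opposite signs. *)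
Lemma tres_swcoef_swcoef l m : tres (diag n s * wcoef l * (diag n s * wcoef m)) =
  (if (n <= m)%N then lser s (l%:Z + m%:Z + 1 - n%:Z) else 0)
  - (if (l < n)%N then lser s (l%:Z + m%:Z + 1 - n%:Z) else 0).
Proof.
have -> : diag n s * wcoef l * (diag n s * wcoef m)
  = diag n s * (diag n s * (wcoef l * wcoef m)).
  by rewrite mulrACA -mulrA.
have tresNN u : tres u = - tres (- u).
  by apply/eqP; rewrite -addr_eq0 -tresD subrr tres0.
case: (ltnP l n) (leqP n m) => ln [] mn.
- rewrite subrr (_ : wcoef l * wcoef m = 0) ?mulr0 ?tres0//.
  by rewrite /wcoef ln ltnNge mn /=; congr pair; rewrite ?mul0r ?mulr0.
- rewrite sub0r tresNN -2!mulrN (@tres_s _ _ (n%:Z - 2 - l%:Z - m%:Z)).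
    by congr (- lser s _); lia.
  rewrite /wcoef ln mn /=.
  have -> : - (((0, - tX (n.-1 - l)) : Aext n R) * (0, - tX (n.-1 - m)))
     = (0, - (tX (n.-1 - l) * tX (n.-1 - m))).
    congr pair; first by rewrite -[LHS]/(- (0 * 0 : laurent R)) mul0r oppr0.
    by rewrite -[LHS]/(- (- tX (n.-1 - l) * - tX (n.-1 - m))) mulrNN.
  rewrite /gap /= tserN opprK add0r.
  have -> : lmono R (n%:Z + (n%:Z - 2 - l%:Z - m%:Z)) =
    tser (tX (n.-1 - l)) * tser (tX (n.-1 - m)).
    by rewrite !tserX ?lmono_lmono; [congr lmono|..]; lia.
  exact: tser_mulP.
- rewrite subr0 (@tres_s _ _ (n%:Z - 2 - l%:Z - m%:Z)).
    by congr (lser s _); lia.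
  rewrite /wcoef !ltnNge ln mn /=.
  have -> : (((lmono R (n%:Z - 1 - l%:Z), 0) : Aext n R) * (lmono R (n%:Z - 1 - m%:Z), 0))
     = (lmono R (n%:Z + (n%:Z - 2 - l%:Z - m%:Z)), 0).
    by congr pair; rewrite ?mul0r // [LHS]lmono_lmono; congr lmono; lia.
  by rewrite /gap /= tser0 subr0 subrr => i _; rewrite lcoef0.
- rewrite subrr (_ : wcoef l * wcoef m = 0) ?mulr0 ?tres0//.
  by rewrite /wcoef mn ltnNge ln /=; congr pair; rewrite ?mul0r ?mulr0.
Qed.

End RelativeResidue.

(** * Change of coefficients *)

Section CoefficientMap.
Variables (n : nat) (R S : comNzRingType) (phi : {rmorphism R -> S}).
Implicit Types (f g : laurent R) (u v : Aext n R) (c : nat -> R).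

Lemma rmorph_conv c c' k : phi (conv c c' k) = conv (phi \o c) (phi \o c') k.
Proof. by rewrite /conv rmorph_sum; apply: eq_bigr => i _; rewrite rmorphM. Qed.

Lemma lmapM f g : lmap phi (f * g) = lmap phi f * lmap phi g.
Proof.
apply: laurentP => k.
have [N fN] := lcoef_bounded f; have [M gM] := lcoef_bounded g.
have pN i : i < N -> lmap phi f i = 0 by move=> /fN /= ->; rewrite rmorph0.
have pM i : i < M -> lmap phi g i = 0 by move=> /gM /= ->; rewrite rmorph0.
rewrite -[RHS]/(lmul_coef (lmap phi f) (lmap phi g) k).
rewrite -[LHS]/(phi (lmul_coef f g k)).
have [kNM|NMk] := ltP k (N + M).
  by rewrite (lmul_coef0 fN gM)// (lmul_coef0 pN pM)// rmorph0.
have -> : k = N + M + (absz (k - (N + M))%R)%:Z by lia.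
by rewrite !lmul_coefE// rmorph_conv.
Qed.

Lemma lmapB f g : lmap phi (f - g) = lmap phi f - lmap phi g.
Proof. by apply: laurentP => k /=; rewrite rmorphB. Qed.

Lemma lmap_lser c : lmap phi (lser c) = lser (phi \o c).
Proof. by apply: laurentP => k /=; case: ifP; rewrite ?rmorph0. Qed.

Lemma lmap_lmono N : lmap phi (lmono R N) = lmono S N.
Proof. by apply: laurentP => k /=; case: ifP; rewrite ?rmorph0 ?rmorph_nat. Qed.

Lemma Aext_mapM u v : Aext_map phi (u * v) = Aext_map phi u * Aext_map phi v.
Proof.
congr pair; first exact: lmapM.
apply/npolyP => k; case: (ltnP k n) => kn; last first.
  by rewrite ![RHS]tcoef_ge ?[LHS]tcoef_ge.
rewrite [LHS]tcoef_mk kn [RHS](@tcoefM _ _ (Aext_map phi u).2 (Aext_map phi v).2)//.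
rewrite (@tcoefM _ _ u.2 v.2)//; apply: etrans (rmorph_conv _ _ _) _.
by apply: conv_eq => i ik; rewrite tcoef_mk ifT// (leq_ltn_trans ik).
Qed.

Lemma Aext_mapD u v : Aext_map phi (u + v) = Aext_map phi u + Aext_map phi v.
Proof.
congr pair; first by apply: laurentP => k; exact: rmorphD.
apply/npolyP => k; rewrite [RHS]coefD !tcoef_mk; case: ifP => _.
  by rewrite coefD; exact: rmorphD.
by rewrite addr0.
Qed.

Lemma Aext_mapZ x u : Aext_map phi (x *: u) = phi x *: Aext_map phi u.
Proof.
congr pair; first by apply: laurentP => k; exact: rmorphM.
apply/npolyP => k; rewrite [RHS]coefZ !tcoef_mk; case: ifP => _.
  by rewrite coefZ; exact: rmorphM.
by rewrite mulr0.
Qed.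

Lemma Aext_map_diag c : Aext_map phi (diag n c) = diag n (phi \o c).
Proof.
congr pair; first exact: lmap_lser.
by apply/npolyP => k; rewrite !tcoef_mk; case: ifP => // ->.
Qed.

Lemma Aext_map0 : Aext_map phi 0 = 0 :> Aext n S.
Proof. by rewrite -(scale0r (0 : Aext n R)) Aext_mapZ rmorph0 scale0r. Qed.

Lemma Aext_map_sum I (r : seq I) (P : pred I) (E : I -> Aext n R) :
  Aext_map phi (\sum_(i <- r | P i) E i) = \sum_(i <- r | P i) Aext_map phi (E i).
Proof. by apply: (big_morph _ Aext_mapD Aext_map0). Qed.

Lemma Aext_map_xdiag k : Aext_map phi (xdiag n R k) = xdiag n S k.
Proof.
by rewrite Aext_map_diag; congr diag; apply/funext => j /=; rewrite rmorph_nat.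
Qed.

Lemma Aext_map_wcoef k : Aext_map phi (wcoef n R k) = wcoef n S k.
Proof.
rewrite /wcoef; case: ifP => kn; congr pair => /=.
- apply: laurentP => i.
  by rewrite [RHS]lcoef0 -[LHS]/(phi ((0 : laurent R) i)) lcoef0 rmorph0.
- apply/npolyP => i; rewrite tcoef_mk !tcoefN !coef_npolyp !coefXn.
  case: ifP => [->|_]; last by rewrite oppr0.
  by rewrite rmorphN; congr (- _); exact: rmorph_nat.
- exact: lmap_lmono.
- apply/npolyP => i; rewrite tcoef_mk [RHS]coef0 -[X in phi X]/((0 : {poly R})`_i).
  by rewrite coef0 rmorph0 if_same.
Qed.

Lemma gap_Aext_map u : gap (Aext_map phi u) = lmap phi (gap u).
Proof.
rewrite /gap lmapB; congr (_ - _); rewrite lmap_lser; congr lser.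
apply/funext => k; rewrite tcoef_mk; case: ltnP => //= nk.
by rewrite tcoef_ge ?rmorph0.
Qed.

Lemma tres_Aext_map (a : laurent R) u :
  tres (lmap phi a) (Aext_map phi u) = phi (tres a u).
Proof. by rewrite /tres gap_Aext_map -lmapM. Qed.

End CoefficientMap.

(** * Iterated residues *)

Section IteratedResidue.
Variables (F : fieldType) (n : nat) (al : int -> F).
Variables (R : comNzRingType) (phi : {rmorphism F -> R}) (t : R -> F).
Hypothesis tD : forall x y, t (x + y) = t x + t y.
Hypothesis tZ : forall c x, t (phi c * x) = c * t x.

Local Notation A := (alpha n al).

Lemma alpha_ord : ordge (- n%:Z) A. Proof. by move=> k kn /=; rewrite kn. Qed.

Lemma lmap_ord (f : laurent F) N : ordge N f -> ordge N (lmap phi f).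
Proof. by move=> fN k /fN /= ->; rewrite rmorph0. Qed.

Lemma tfun0 : t 0 = 0.
Proof. by rewrite -(mulr0 (phi 0)) tZ mul0r. Qed.

Lemma tfun_sum I (r : seq I) (P : pred I) (E : I -> R) :
  t (\sum_(i <- r | P i) E i) = \sum_(i <- r | P i) t (E i).
Proof. by apply: (big_morph _ tD tfun0). Qed.

(** The iterated functional first takes the residue in the outermost variable,
    with values in the coefficient ring, and then applies t.  This reduces it to
    the one-variable theory above. *)
Lemma tnextE (u : Aext n R) : tnext al t u = t (tres (lmap phi A) u).
Proof.
have t1x k : t1 al ((lmono F k, 0) : Aext n F) = A (- 1 - k).
  rewrite -[LHS]/(tres A ((lmono F k, 0) : Aext n F)) /tres.
  rewrite -[gap _]/(lmono F k - tser (0 : tpoly n F)) tser0 subr0.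
  by rewrite mulrC /res lmonoM.
have t1X k : (k < n)%N -> t1 al ((0, npolyp n 'X^k) : Aext n F) = - A (- 1 - k%:Z).
  move=> kn; rewrite -[LHS]/(tres A ((0, tX n F k) : Aext n F)) /tres.
  rewrite -[gap _]/((0 : laurent F) - tser (tX n F k)) tserX//.
  by rewrite sub0r mulrN -[LHS]/(- (A * lmono F k) (-1)) mulrC lmonoM.
have aP := lmap_ord alpha_ord.
rewrite /tres /gap mulrBr -[res _]/(res (lmap phi A * u.1) - res (lmap phi A * tser u.2)).
rewrite -mulN1r tD; congr (_ + _).
  (* x^m u.1 is a power series, which makes the sum over all of Z finite. *)
  have [M uM] := lcoef_bounded u.1; pose m := `|M|%N.
  have uE : u.1 = lmono R (- m%:Z) * lser (fun k => u.1 (k%:Z - m%:Z)).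
    apply: laurentP => k; rewrite lmonoM lserE opprK; case: ltP => km.
      by rewrite uM//; lia.
    by congr (lcoef _ _); lia.
  rewrite [in RHS]uE mulrA mulrC (@res_lserM _ _ _ (m + n)%N); last first.
    rewrite PoszD opprD mulrC; apply: ordgeM => // k km /=.
    by rewrite km.
  rewrite tfun_sum -(fsbig_widen [set` [seq k%:Z - m%:Z | k <- iota 0 (m
    + n)]] [set: int])//; last first.
    move=> i /= [_ /negP ir].
    have [Mi|/uM->] := leP M i; last by rewrite tfun0 mul0r.
    rewrite t1x alpha_ord ?mulr0//; suff : n%:Z <= i by lia.
    rewrite leNgt; apply: contra ir => ik; apply/mapP.
    by exists `|(i + m%:Z)%R|%N; [rewrite mem_iota; lia | lia].
  rewrite -fsbig_seq; last by rewrite map_inj_uniq ?iota_uniq// => i j /addIr [].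
  rewrite big_map (_ : iota 0 (m + n) = index_iota 0 (m + n)); last first.
    by rewrite /index_iota subn0.
  rewrite big_mkord.
  apply: eq_bigr => k _; rewrite [lmap _ _ * _]mulrC lmonoM t1x mulrC -tZ.
  rewrite mulrC; congr (t (_ * _)); congr (phi (lcoef _ _)); ring.
rewrite [_ * tser _]mulrC mulN1r (@res_lserM _ _ _ n)// -sumrN tfun_sum;
  apply: eq_bigr => k _.
rewrite t1X// mulrC -tZ rmorphN mulNr mulrC.
by [].
Qed.

Lemma tnextD u v : tnext (n := n) al t (u + v) = tnext al t u + tnext al t v.
Proof. by rewrite !tnextE tresD tD. Qed.

Lemma tnextZ c (u : Aext n R) : tnext al t (phi c *: u) = c * tnext al t u.
Proof. by rewrite !tnextE tresZ tZ. Qed.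

(** A power series in the outermost variable is paired termwise with f. *)
Lemma tnext_diag (f : Aext n F) : exists N, forall m, (N <= m)%N ->
  forall y c, tnext al t (y *: (Aext_map phi f * diag n c)) =
    \sum_(k < m) t1 al (xdiag n F k * f) * t (y * c k).
Proof.
have aP := lmap_ord alpha_ord.
have [N NP] := tres_diagE aP (Aext_map phi f); exists N => m Nm y c.
have [_ mP] := NP _ Nm.
rewrite tnextE tresZ mulrC [_ * diag n c]mulrC mP -mulrC mulr_sumr tfun_sum.
apply: eq_bigr => k _.
rewrite -(Aext_map_xdiag _ phi) -Aext_mapM tres_Aext_map mulrA mulrC tZ.
by [].
Qed.

End IteratedResidue.

(** * Structure constants in an orthonormal basis *)

Section KillingForm.
Variables (F : fieldType) (g : vectType F) (br : g -> g -> g).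
Hypothesis brP : lie_bracket br.
Implicit Types x y z : g.

Lemma lieDl x y z : br (x + y) z = br x z + br y z.
Proof. by have := lie_linearl brP z 1 x y; rewrite !scale1r. Qed.

Lemma lieDr x y z : br x (y + z) = br x y + br x z.
Proof. by have := lie_linearr brP x 1 y z; rewrite !scale1r. Qed.

Lemma lieNr x y : br x (- y) = - br x y.
Proof.
have br0 : br x 0 = 0 by apply: (addrI (br x 0)); rewrite -lieDr !addr0.
by apply/eqP; rewrite -addr_eq0 -lieDr addNr br0.
Qed.

Lemma lie_anti x y : br x y = - br y x.
Proof.
have := lie_alternating brP (x + y).
rewrite lieDl !lieDr !(lie_alternating brP) add0r addr0 => /eqP.
by rewrite addr_eq0 => /eqP.
Qed.

Lemma linfunE (f : g -> g) v : linear f -> linfun f v = f v.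
Proof.
move=> fl; pose h : {linear g -> g} := HB.pack f (GRing.isLinear.Build F g g _ f fl).
exact: (lfunE h).
Qed.

Definition ad_mx x :=
  passmx.mxof (vbasis (fullv : {vspace g})) (vbasis fullv) (linfun (br x)).

Lemma killingE x y : killing br x y = \tr (ad_mx y *m ad_mx x).
Proof.
by rewrite /killing (passmx.mxof_comp _ _ (vbasisP fullv)).
Qed.

Lemma killingC x y : killing br x y = killing br y x.
Proof. by rewrite !killingE mxtrace_mulC. Qed.

Lemma ad_mx_linear c x y : ad_mx (c *: x + y) = c *: ad_mx x + ad_mx y.
Proof.
apply: (etrans _ (passmx.mxof_linear _ _ c _ _)); congr (passmx.mxof _ _ _);
  apply/lfunP => v.
by rewrite add_lfunE scale_lfunE !linfunE; [exact: (lie_linearl brP)|..];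
  exact: lie_linearr.
Qed.

Lemma ad_mx_br x y : ad_mx (br x y) = ad_mx y *m ad_mx x - ad_mx x *m ad_mx y.
Proof.
rewrite /ad_mx -!(passmx.mxof_comp _ _ (vbasisP fullv)) addrC -scaleN1r.
apply: (etrans _ (passmx.mxof_linear _ _ (-1) _ _)).
congr (passmx.mxof _ _ _); apply/lfunP => v.
rewrite add_lfunE scale_lfunE scaleN1r addrC !comp_lfunE !linfunE; try exact: lie_linearr.
rewrite [LHS]lie_anti [in RHS](lie_anti x v) lieNr.
rewrite opprK; apply/eqP; rewrite eq_sym -addr_eq0; apply/eqP.
exact: lie_jacobi.
Qed.

(** ad is a representation by the Jacobi identity, and the trace is cyclic. *)
Lemma killing_invariant x y z : killing br (br x y) z = killing br x (br y z).
Proof.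
rewrite !killingE !ad_mx_br mulmxBr mulmxBl !raddfB /= !mulmxA; congr (_ - _).
by rewrite mxtrace_mulC mulmxA.
Qed.

Lemma killing_linear c x y z :
  killing br (c *: x + y) z = c * killing br x z + killing br y z.
Proof. by rewrite !killingE ad_mx_linear mulmxDr -scalemxAr mxtraceD mxtraceZ. Qed.

Variables (d : nat) (b : d.-tuple g).
Hypothesis bP : orthonormal_basis br b.

Definition struct_const (i j k : 'I_d) : F := coord b k (br (tnth b i) (tnth b j)).

Lemma coord_tnth (i j : 'I_d) : coord b i (tnth b j) = (i == j)%:R.
Proof.
rewrite (tnth_nth 0) coord_free ?(basis_free (proj1 bP))//.
by rewrite eq_sym.
Qed.

Lemma coord_killing (k : 'I_d) x : coord b k x = killing br x (tnth b k).
Proof.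
have k0 z : killing br 0 z = 0.
  have := killing_linear 1 0 0 z; rewrite scaler0 addr0 mul1r => E.
  by apply: (addrI (killing br 0 z)); rewrite -E addr0.
have kD u v : killing br (u + v) (tnth b k)
  = killing br u (tnth b k) + killing br v (tnth b k).
  by have := killing_linear 1 u v (tnth b k); rewrite scale1r mul1r.
have kZ c u : killing br (c *: u) (tnth b k) = c * killing br u (tnth b k).
  by have := killing_linear c u 0 (tnth b k); rewrite k0 !addr0.
rewrite [in RHS](coord_basis (proj1 bP) (memvf x)).
rewrite (big_morph (fun u => killing br u (tnth b k)) kD (k0 _)).
rewrite (bigD1 k)//= big1 => [|i ik]; rewrite kZ -tnth_nth (proj2 bP).
  by rewrite eqxx mulr1 addr0.
by rewrite (negPf ik) mulr0.
Qed.

(** In an orthonormal basis the structure constants are the values of the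
    invariant trilinear form kappa([x, y], z). *)
Lemma struct_const_cyclic i j k : struct_const i j k = struct_const j k i.
Proof. by rewrite /struct_const !coord_killing killing_invariant killingC. Qed.

Lemma struct_const_anti i j k : struct_const i j k = - struct_const j i k.
Proof. by rewrite /struct_const lie_anti linearN. Qed.

End KillingForm.

(** * Complements of the diagonal *)

Lemma sum_ord_if (V : nmodType) (G : nat -> V) (N m : nat) : (N <= m)%N ->
  \sum_(k < m) (if (k < N)%N then G k else 0) = \sum_(k < N) G k.
Proof. by move=> Nm; rewrite [RHS](big_ord_widen m G Nm) [RHS]big_mkcond. Qed.

Lemma sum_delta1 (R : pzSemiRingType) (I : finType) (G : I -> R) (i0 : I) :
  \sum_i (i == i0)%:R * G i = G i0.
Proof.
rewrite (bigD1 i0)//= eqxx mul1r big1 ?addr0// => i /negPf ->.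
by rewrite mul0r.
Qed.

Section Manin.
Variables (F : fieldType) (g : vectType F) (br : g -> g -> g).
Variables (d : nat) (b : d.-tuple g).
Hypothesis bP : orthonormal_basis br b.
Variables (n : nat) (al : int -> F) (s : nat -> F).
Hypothesis sP : lser s * (lmono F n%:Z * alpha n al) = 1.

Local Notation A1 := (Aext n F).
Local Notation L := (Lalg F d n).
Local Notation t := (t1 al).
Local Notation LB := (LB br b al).
Local Notation series_of := (mk_series b n s).
Implicit Types (u v : L) (h : gg_series F d) (f : nat -> 'I_d -> F).
Implicit Types (k l m : nat) (i j p q : 'I_d).

Definition swcoef l : A1 := diag n s * wcoef n F l.

Lemma t1D (x y : A1) : t (x + y) = t x + t y. Proof. exact: tresD. Qed.
Lemma t1Z c (x : A1) : t (c *: x) = c * t x. Proof. exact: tresZ. Qed.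
Lemma t10 : t (0 : A1) = 0. Proof. exact: tres0. Qed.
Lemma t1_diagM c c' : t (diag n c * diag n c') = 0.
Proof. by rewrite diagM; exact: (tres_diag (@alpha_ord F n al)). Qed.

Lemma t1_diag_swcoef c l : t (diag n c * swcoef l) = c l.
Proof. exact: (tres_diag_swcoef (@alpha_ord F n al) sP). Qed.

(** In each of the two sums defining the quotient at most one index
    contributes. *)
Lemma divxy_swap l m : divxy (swap_num n s) l m =
  (if (n <= m)%N then lser s (l%:Z + m%:Z + 1 - n%:Z) else 0)
  - (if (l < n)%N then lser s (l%:Z + m%:Z + 1 - n%:Z) else 0).
Proof.
rewrite /divxy /swap_num sumrB; congr (_ - _).
  case: leqP => nm; last first.
    rewrite big1// => j _; rewrite (_ : _ == n = false) ?mulr0//.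
    by apply/negbTE; have := ltn_ord j; lia.
  have jm : (m - n < m.+1)%N by lia.
  rewrite (bigD1 (Ordinal jm))//= big1 => [|j /eqP jn].
    rewrite subKn// eqxx mulr1 addr0 ifF; last by lia.
    by congr s; lia.
  rewrite (_ : _ == n = false) ?mulr0//; apply/negbTE/eqP => jn'; apply: jn.
  by apply/val_inj => /=; have := ltn_ord j; lia.
case: ltnP => ln; last first.
  by rewrite big1// => j _; rewrite (_ : _ == n = false) ?mulr0//; lia.
rewrite lserE; case: ltP => lm.
  rewrite big1// => j _; rewrite (_ : _ == n = false) ?mulr0//.
  by have := ltn_ord j; lia.
have jm : (n - l.+1 < m.+1)%N by lia.
rewrite (bigD1 (Ordinal jm))//= big1 => [|j /eqP jn].
  rewrite (_ : _ == n) ?mulr1 ?addr0; last by lia.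
  by congr s; lia.
rewrite (_ : _ == n = false) ?mulr0//; apply/negbTE/eqP => jn'; apply: jn.
by apply/val_inj => /=; lia.
Qed.

(** This is why the correction term of rbar is what makes W(rbar) orthogonal to
    W(r). *)
Lemma t1_swcoef_swcoef l m : t (swcoef l * swcoef m) = divxy (swap_num n s) l m.
Proof. by rewrite divxy_swap; exact: (tres_swcoef_swcoef (@alpha_ord F n al) sP). Qed.

Lemma series_ofE h l q i :
  series_of h l q i = (i == q)%:R *: swcoef l + diag n (fun k => h k l i q).
Proof.
rewrite /mk_series /Lact /w /pure /Ldiag !ffunE (coord_tnth bP).
by rewrite -scalerAr.
Qed.

Lemma LBE u v : LB u v = \sum_i t (u i * v i).
Proof.
apply: eq_bigr => i _; rewrite (bigD1 i)//= big1 => [|j ji]; rewrite (proj2 bP).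
  by rewrite eqxx mul1r addr0.
by rewrite eq_sym (negPf ji) mul0r.
Qed.

Lemma LBC u v : LB u v = LB v u.
Proof. by rewrite !LBE; apply: eq_bigr => i _; rewrite mulrC. Qed.

Lemma LBDl u u' v : LB (u + u') v = LB u v + LB u' v.
Proof.
rewrite !LBE -big_split; apply: eq_bigr => i _ /=.
by rewrite ffunE mulrDl t1D.
Qed.

Lemma LBZl c u v : LB (c *: u) v = c * LB u v.
Proof.
rewrite !LBE mulr_sumr; apply: eq_bigr => i _.
by rewrite ffunE -scalerAl t1Z.
Qed.

Lemma LB0l v : LB 0 v = 0.
Proof. by rewrite -(scale0r (0 : L)) LBZl mul0r. Qed.

Lemma LB_suml I (r : seq I) (P : pred I) (E : I -> L) v :
  LB (\sum_(i <- r | P i) E i) v = \sum_(i <- r | P i) LB (E i) v.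
Proof. by apply: (big_morph (fun u => LB u v) (fun u u' => LBDl u u' v) (LB0l v)). Qed.

Lemma LB_lcombl m f (r : series F d n) v :
  LB (\sum_(k < m) \sum_i f k i *: r k i) v = \sum_(k < m) \sum_i f k i * LB (r k i) v.
Proof.
rewrite LB_suml; apply: eq_bigr => k _; rewrite LB_suml; apply: eq_bigr => i _.
exact: LBZl.
Qed.

(** The pairing of v with b_i x^k. *)
Definition pairx v k i : F := t (xdiag n F k * v i).

Lemma pairxD u v k i : pairx (u + v) k i = pairx u k i + pairx v k i.
Proof. by rewrite /pairx ffunE mulrDr t1D. Qed.

Lemma pairxZ c v k i : pairx (c *: v) k i = c * pairx v k i.
Proof. by rewrite /pairx ffunE -scalerAr t1Z. Qed.

Lemma pairx0 k i : pairx 0 k i = 0.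
Proof. by rewrite -(scale0r (0 : L)) pairxZ mul0r. Qed.

Lemma pairx_sum I (r : seq I) (P : pred I) (E : I -> L) k i :
  pairx (\sum_(i <- r | P i) E i) k i = \sum_(j <- r | P j) pairx (E j) k i.
Proof.
by apply: (big_morph (fun u => pairx u k i) (fun u u' => pairxD u u' k i) (pairx0 k i)).
Qed.

Lemma pairx_Ldiag f k i : pairx (Ldiag n f) k i = 0.
Proof. by rewrite /pairx ffunE t1_diagM. Qed.

(** The power series part of r pairs to zero with the diagonal, so any series of
    type (n, s) is dual to the b_i x^k. *)
Lemma pairx_series h l q k i : pairx (series_of h l q) k i = ((l == k) && (i == q))%:R.
Proof.
rewrite /pairx series_ofE mulrDr t1D -scalerAr t1Z t1_diag_swcoef t1_diagM addr0.
by rewrite -natrM mulnb andbC.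
Qed.

Lemma sum_delta m f k i :
  \sum_(l < m) \sum_q f l q * ((l == k :> nat) && (i == q))%:R
  = if (k < m)%N then f k i else 0.
Proof.
have E l : \sum_q f l q * ((l == k :> nat) && (i == q))%:R = f l i * (l == k)%:R.
  rewrite (bigD1 i)//= big1 => [|q qi];
    last by rewrite [i == q]eq_sym (negPf qi) andbF mulr0.
  by rewrite eqxx andbT addr0.
under eq_bigr do rewrite E.
case: ltnP => km.
  rewrite (bigD1 (Ordinal km))//= big1 => [|l /eqP lk].
    by rewrite eqxx mulr1 addr0.
  by case: eqP => [lk'|_]; [case: lk; exact: val_inj|rewrite mulr0].
rewrite big1// => l _; case: eqP => [lk|_]; last by rewrite mulr0.
by have := ltn_ord l; lia.
Qed.

Lemma pairx_lcomb h m f k i :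
  pairx (\sum_(l < m) \sum_q f l q *: series_of h l q) k i
    = if (k < m)%N then f k i else 0.
Proof.
rewrite -sum_delta pairx_sum; apply: eq_bigr => l _; rewrite pairx_sum.
by apply: eq_bigr => q _; rewrite pairxZ pairx_series.
Qed.

Lemma LB_series_Ldiag h l q f : LB (series_of h l q) (Ldiag n f) = f l q.
Proof.
have tE i : t (series_of h l q i * Ldiag n f i) = (i == q)%:R * f l i.
  by rewrite series_ofE ffunE mulrDl t1D -scalerAl t1Z [swcoef l
    * _]mulrC t1_diag_swcoef t1_diagM addr0.
rewrite LBE (bigD1 q)//= big1 ?addr0 => [|i iq]; rewrite tE; first by rewrite eqxx mul1r.
by rewrite (negPf iq) mul0r.
Qed.

Lemma LB_Ldiag u : exists N, forall m, (N <= m)%N ->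
  (forall k i, (m <= k)%N -> pairx u k i = 0) /\
  forall f, LB (Ldiag n f) u = \sum_(k < m) \sum_i f k i * pairx u k i.
Proof.
have /choice[N NP] i := tres_diagE (@alpha_ord F n al) (u i).
have leN i : (N i <= \max_i N i)%N by exact: leq_bigmax.
exists (\max_i N i) => m Nm; split => [k i mk|f].
  by have [] := NP i k (leq_trans (leN i) (leq_trans Nm mk)).
rewrite LBE exchange_big; apply: eq_bigr => i _; rewrite ffunE.
by have [_ cE] := NP i m (leq_trans (leN i) Nm); exact: cE.
Qed.

Lemma Ldiag_of_pairx v : (forall k i, pairx v k i = 0) -> exists f, v = Ldiag n f.
Proof.
move=> v0; have /choice[c cP] i := tres_xdiag0_diag (@alpha_ord F n al) sP (v0^~ i).
exists (fun k i => c i k); apply/ffunP => i; rewrite ffunE; exact: cP.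
Qed.

(** Subtracting the combination of the r_(k,i) with the same pairings as v leaves
    an element orthogonal to all b_i x^k, hence diagonal. *)
Lemma series_decomp h v : exists N, forall m, (N <= m)%N -> exists f,
  v = Ldiag n f + \sum_(k < m) \sum_i pairx v k i *: series_of h k i.
Proof.
have [N NP] := LB_Ldiag v; exists N => m /NP[v0 _].
pose w := \sum_(k < m) \sum_i pairx v k i *: series_of h k i.
have [f fE] : exists f, v - w = Ldiag n f.
  apply: Ldiag_of_pairx => k i; rewrite pairxD -scaleN1r pairxZ pairx_lcomb.
  by case: ltnP => [_|/v0->]; rewrite mulN1r ?subrr// oppr0 addr0.
by exists f; rewrite -fE subrK.
Qed.

Lemma W_lcomb (r : series F d n) m f : W r (\sum_(k < m) \sum_i f k i *: r k i).
Proof. by exists m, f. Qed.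

Lemma W_mem h k i : W (series_of h) (series_of h k i).
Proof.
exists k.+1, (fun l q => ((k == l) && (q == i))%:R).
rewrite (bigD1 ord_max)//= [X in _ + X]big1 ?addr0 => [|l /eqP lk]; last first.
  rewrite big1// => q _; case: eqP => /= [kl|_]; last by rewrite scale0r.
  by case: lk; apply: val_inj.
rewrite (bigD1 i)//= big1 => [|q /negPf ->]; first by rewrite !eqxx scale1r addr0.
by rewrite andbF scale0r.
Qed.

(** Duality recovers the coefficients of an element of W(r) on the generators,
    so they need not be chosen. *)
Lemma W_expand h v : W (series_of h) v -> exists N, forall m, (N <= m)%N ->
  (forall k i, (m <= k)%N -> pairx v k i = 0) /\
  v = \sum_(k < m) \sum_i pairx v k i *: series_of h k i.
Proof.
move=> [N [c ->]]; exists N => m Nm; split=> [k i mk|].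
  by rewrite pairx_lcomb ltnNge (leq_trans Nm mk).
rewrite -[LHS](sum_ord_if (fun k => \sum_i c k i *: series_of h k i) Nm).
apply: eq_bigr => k _; case: ifP => kN.
  by apply: eq_bigr => i _; rewrite pairx_lcomb kN.
by rewrite big1// => i _; rewrite pairx_lcomb kN scale0r.
Qed.

Lemma W_subspace h : subspace (W (series_of h)).
Proof.
split.
  by exists 0%N, (fun _ _ => 0); rewrite big_ord0.
move=> c u v /W_expand[N NP] /W_expand[M MP].
have [_ uE] := NP _ (leq_maxl N M); have [_ vE] := MP _ (leq_maxr N M).
exists (maxn N M), (fun k i => c * pairx u k i + pairx v k i).
rewrite [in LHS]uE [in LHS]vE scaler_sumr -big_split; apply: eq_bigr => k _ /=.
rewrite scaler_sumr -big_split; apply: eq_bigr => i _ /=.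
by rewrite scalerDl scalerA.
Qed.

Lemma W_compl h : direct_sum Delta (W (series_of h)).
Proof.
split=> [v|v [f _ <-] /W_expand[N /(_ N (leqnn _))[_ ->]]].
  have [N /(_ _ (leqnn N))[f fE]] := series_decomp h v.
  exists (Ldiag n f), (\sum_(k < N) \sum_i pairx v k i *: series_of h k i).
  by split=> //; [exists f|exact: (W_lcomb _ _ (pairx v))].
by rewrite big1// => k _; rewrite big1// => i _; rewrite pairx_Ldiag scale0r.
Qed.

Lemma subspace_lcomb (V : set L) m f (r : series F d n) : subspace V ->
  (forall k i, V (r k i)) -> V (\sum_(k < m) \sum_i f k i *: r k i).
Proof.
move=> [V0 VD] rV.
have VS I (x : seq I) (P : pred I) (E : I -> L) :
    (forall e, V (E e)) -> V (\sum_(e <- x | P e) E e).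
  move=> VE; apply: (big_ind V) => [//|u v Vu Vv|e _]; last exact: VE.
  by rewrite -[u]scale1r; exact: VD.
apply: (VS) => k; apply: (VS) => i; rewrite -[_ *: _]addr0; exact: VD.
Qed.

(** Injectivity: two series with the same W differ by diagonal elements lying
    in W.  Surjectivity: correcting each s w_(l,q) by a diagonal element puts it
    into V, and the corrections are the power series part of r. *)
Lemma W_bij : set_bij (type_series b n s)
  [set V | subspace V /\ direct_sum (@Delta F d n) V] W.
Proof.
split.
- by move=> _ [h _ <-] /=; split; [exact: W_subspace|exact: W_compl].
- move=> r r' /set_mem[h _ <-] /set_mem[h' _ <-] WE.
  have [_ dir] := W_compl h'.
  apply/funext => l; apply/funext => q; apply/eqP; rewrite -subr_eq0; apply/eqP.
  apply: dir; last first.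
    have [_ sub] := W_subspace h'; rewrite addrC -scaleN1r.
    apply: sub; first exact: W_mem.
    by rewrite -WE; exact: W_mem.
  exists (fun k i => h k l i q - h' k l i q); first by [].
  apply/ffunP => i; rewrite [LHS]ffunE diagB !ffunE opprD addrACA subrr add0r.
  by [].
- move=> V [Vsub [Vex Vdir]].
  have ex l q : exists f, V (Lact s (w b n l q) + Ldiag n f).
    have [_ [v [[f _ <-] Vv E]]] := Vex (Lact s (w b n l q)).
    exists (fun k i => - f k i).
    rewrite E addrC addrA (_ : Ldiag n _ + Ldiag n f = 0) ?add0r//.
    apply/ffunP => i; rewrite !ffunE -diagD -diag0.
    by congr diag; apply/funext => k; rewrite addNr.
  have /choice[f fP] (lq : nat * 'I_d) := ex lq.1 lq.2.
  pose h : gg_series F d := fun k l => \matrix_(p, q) f (l, q) k p.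
  have Vr l q : V (series_of h l q).
    have E : (fun k p => h k l p q) = f (l, q).
      by apply/funext => k; apply/funext => i; rewrite mxE.
    rewrite -[series_of h l q]/(Lact s (w b n l q) + Ldiag n (fun k p => h k l p q)) E.
    exact: (fP (l, q)).
  exists (series_of h); first by exists h.
  apply/seteqP; split => [_ [N [c ->]]|v Vv].
    exact: (@subspace_lcomb V N c (series_of h) Vsub Vr).
  have [_ [u [[f' _ <-] Wu vE]]] := (W_compl h).1 v.
  suff : Ldiag n f' = 0 by move=> f0; rewrite vE f0 add0r.
  apply: Vdir; first by exists f'.
  have Vu : V u by case: Wu => N [c ->];
    exact: (@subspace_lcomb V N c (series_of h) Vsub Vr).
  have -> : Ldiag n f' = (-1) *: u + v by rewrite vE scaleN1r addrC addrK.
  exact: Vsub.2.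
Qed.

(** The pairing of the polar parts is cancelled by the correction term of rbar,
    and the cross terms by the transposition of the power series part. *)
Lemma LB_series_bar h l q m p : LB (series_of h l q) (series_of (bar n s h) m p) = 0.
Proof.
have tE i : t (series_of h l q i * series_of (bar n s h) m p i) =
  (i == q)%:R * ((i == p)%:R * divxy (swap_num n s) l m)
  + ((i == q)%:R * bar n s h l m i p + (i == p)%:R * h m l i q).
  rewrite !series_ofE mulrDl !mulrDr !t1D -!scalerAl !t1Z -!scalerAr !t1Z t1_swcoef_swcoef.
  rewrite [swcoef l * _]mulrC 2!t1_diag_swcoef.
  by rewrite [X in _ + (_ + X)]t1_diagM addr0 -addrA.
rewrite LBE (eq_bigr _ (fun i _ => tE i)) !big_split /= !sum_delta1.
by rewrite /bar !mxE mulr_natl; ring.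
Qed.

(** An element orthogonal to W(r) differs from an element of W(rbar) by a diagonal
    element which is still orthogonal to W(r); duality makes the latter zero. *)
Lemma W_orthog h :
  Lorthog br b al (W (series_of h)) = W (series_of (bar n s h)).
Proof.
apply/seteqP; split => [v vW|v [N [c ->]] _ [M [e ->]]]; last first.
  rewrite LB_lcombl big1// => k _; rewrite big1// => i _.
  rewrite LBC LB_lcombl big1 ?mulr0// => l _.
  by rewrite big1// => j _; rewrite LB_series_bar mulr0.
have [N /(_ _ (leqnn N))[f vE]] := series_decomp (bar n s h) v.
suff f0 : Ldiag n f = 0.
  rewrite vE f0 add0r; exact: (W_lcomb _ _ (pairx v)).
have fE l q : f l q = 0.
  rewrite -(LB_series_Ldiag h) LBC -(vW _ (W_mem h l q)) [in RHS]vE LBDl.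
  rewrite LB_lcombl [X in _ + X]big1 ?addr0// => k _; rewrite big1// => i _.
  by rewrite LBC LB_series_bar mulr0.
apply/ffunP => i; rewrite !ffunE -diag0; congr diag; apply/funext => k.
exact: fE.
Qed.

End Manin.

(** * The Yang-Baxter identity in the second variable *)

Lemma sum_addsub (V : zmodType) (I : finType) (a1 a2 a3 a4 c : I -> V) :
  (forall i, c i = a1 i + a2 i + a3 i - a4 i) ->
  \sum_i c i = \sum_i a1 i + \sum_i a2 i + \sum_i a3 i - \sum_i a4 i.
Proof. by move=> cE; rewrite (eq_bigr _ (fun i _ => cE i)) !big_split /= sumrN. Qed.

Section DiagSum.
Variables (n : nat) (R : comNzRingType).

Lemma diag_sum I (r : seq I) (P : pred I) (E : I -> nat -> R) :
  diag n (fun k => \sum_(i <- r | P i) E i k) = \sum_(i <- r | P i) diag n (E i).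
Proof.
elim: r => [|x r IH].
  by rewrite big_nil -diag0; congr diag; apply/funext => k; rewrite big_nil.
rewrite big_cons -IH; case: ifP => Px.
  by rewrite -diagD; congr diag; apply/funext => k; rewrite big_cons Px.
by congr diag; apply/funext => k; rewrite big_cons Px.
Qed.

Lemma mul_alg_diag (y : R) c : in_alg (Aext n R) y * diag n c = diag n (fun k => y * c k).
Proof. by rewrite mulr_algl diagZ. Qed.

End DiagSum.

Section MainIdentity.
Variables (F : fieldType) (g : vectType F) (br : g -> g -> g).
Hypothesis brP : lie_bracket br.
Variables (d : nat) (b : d.-tuple g).
Hypothesis bP : orthonormal_basis br b.
Variables (n : nat) (al : int -> F) (s : nat -> F).
Hypothesis sP : lser s * (lmono F n%:Z * alpha n al) = 1.

Local Notation A1 := (Aext n F).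
Local Notation A2 := (Aext n A1).
Local Notation L := (Lalg F d n).
Local Notation t := (t1 al).
Local Notation sc := (struct_const br b).
Local Notation LB := (LB br b al).
Local Notation Lbr := (Lbr br b).
Local Notation series_of := (mk_series b n s).
Local Notation M := (Aext_map (in_alg A1)).
Implicit Types (u v : L) (h : gg_series F d) (f : nat -> 'I_d -> F).
Implicit Types (k l m : nat) (i j p q : 'I_d).

Lemma LbrE u v p : Lbr u v p = \sum_i \sum_j sc i j p *: (u i * v j).
Proof.
rewrite /Defs.Lbr sum_ffunE; apply: eq_bigr => i _; rewrite sum_ffunE.
by apply: eq_bigr => j _; rewrite ffunE.
Qed.

Lemma Lbr_anti u v : Lbr u v = - Lbr v u.
Proof.
apply/ffunP => p; rewrite [RHS]ffunE !LbrE exchange_big -sumrN; apply: eq_bigr => i _.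
rewrite -sumrN; apply: eq_bigr => j _.
by rewrite (struct_const_anti brP) scaleNr mulrC.
Qed.

(** The residue in the second variable of A_2, with values in A_1. *)
Definition tau (z : A2) : A1 := tres (lmap (in_alg A1) (alpha n al)) z.

Lemma alphaA1_ord : ordge (- n%:Z) (lmap (in_alg A1) (alpha n al)).
Proof. exact: (lmap_ord (in_alg A1) (@alpha_ord F n al)). Qed.

Lemma sPA1 : lser (in_alg A1 \o s) * (lmono A1 n%:Z * lmap (in_alg A1) (alpha n al)) = 1.
Proof.
rewrite -(lmap_lser (in_alg A1)) -(lmap_lmono (in_alg A1)) -!(lmapM (in_alg A1)) sP.
exact: (lmap_lmono (in_alg A1)).
Qed.

Lemma tauD x y : tau (x + y) = tau x + tau y. Proof. exact: tresD. Qed.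
Lemma tauZ c x : tau (c *: x) = c * tau x. Proof. exact: tresZ. Qed.
Lemma tau0 : tau 0 = 0. Proof. exact: tres0. Qed.
Lemma tau_sum I (r : seq I) (P : pred I) (E : I -> A2) :
  tau (\sum_(i <- r | P i) E i) = \sum_(i <- r | P i) tau (E i).
Proof. by apply: (big_morph _ tauD tau0). Qed.

Lemma tau_diagM c c' : tau (diag n c * diag n c') = 0.
Proof. by rewrite diagM; exact: (tres_diag alphaA1_ord). Qed.

Lemma tau_M (x : A1) : tau (M x) = in_alg A1 (t x).
Proof. exact: tres_Aext_map. Qed.

Lemma M_mulCA (x y : A1) (z : A2) : M x * (z * M y) = z * M (y * x).
Proof.
rewrite (Aext_mapM (in_alg A1)); apply: (etrans (mulrC _ _)).
exact: (esym (mulrA _ _ _)).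
Qed.

Lemma tau_M_alg_M (x y z : A1) :
  tau (M x * (in_alg A2 z * M y)) = z * in_alg A1 (t (y * x)).
Proof. by rewrite M_mulCA mulr_algl tauZ tau_M. Qed.

Lemma M_series h l q i : M (series_of h l q i) =
  in_alg A1 (i == q)%:R *: (diag n (in_alg A1 \o s) * wcoef n A1 l)
  + diag n (in_alg A1 \o (fun k => h k l i q)).
Proof.
rewrite (series_ofE bP) (Aext_mapD (in_alg A1)) (Aext_mapZ (in_alg A1))
  (Aext_map_diag _ (in_alg A1)).
by rewrite (Aext_mapM (in_alg A1)) (Aext_map_diag _ (in_alg A1)) (Aext_map_wcoef n
  (in_alg A1)).
Qed.

Lemma tau_diag_series c h l q i :
  tau (diag n c * M (series_of h l q i)) = (i == q)%:R *: c l.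
Proof.
rewrite M_series mulrDr tauD [X in _ + X]tau_diagM addr0 -scalerAr tauZ.
rewrite /tau (tres_diag_swcoef alphaA1_ord sPA1) mulr_algl.
by [].
Qed.

(** The residue pairing in the second variable is non-degenerate: orthogonality
    to the diagonal makes X diagonal, and then the pairings with the r_(m,e) are its
    coefficients. *)
Lemma A2_eq0 h (X : 'I_d -> A2) :
  (forall m q, tau (xdiag n A1 m * X q) = 0) ->
  (forall m e, \sum_q tau (M (series_of h m e q) * X q) = 0) ->
  forall q, X q = 0.
Proof.
move=> Xdiag XW.
have /choice[c cP] q := tres_xdiag0_diag alphaA1_ord sPA1 (Xdiag^~ q).
move=> e; rewrite cP -diag0; congr diag; apply/funext => m.
rewrite -(XW m e) (eq_bigr (fun q => in_alg A1 (q == e)%:R * c q m)) => [|q _].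
  rewrite (bigD1 e)//= eqxx big1 => [|q /negPf ->]; first by rewrite scale1r mul1r addr0.
  by rewrite scale0r mul0r.
by rewrite cP mulrC tau_diag_series mulr_algl.
Qed.

(** Component p of the projection of v to W(r) along the diagonal, written as a
    residue in the second variable of the product of r and v. *)
Definition Wproj h p v : A1 :=
  \sum_j tau (diag n (fun k => series_of h k j p) * M (v j)).

Lemma WprojD h p u v : Wproj h p (u + v) = Wproj h p u + Wproj h p v.
Proof.
rewrite -big_split; apply: eq_bigr => j _ /=.
by rewrite ffunE (Aext_mapD (in_alg A1)) mulrDr tauD.
Qed.

Lemma WprojZ h p c v : Wproj h p (c *: v) = c *: Wproj h p v.
Proof.
rewrite scaler_sumr; apply: eq_bigr => j _ /=.
by rewrite ffunE (Aext_mapZ (in_alg A1)) -scalerAr tauZ mulr_algl.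
Qed.

Lemma Wproj0 h p : Wproj h p 0 = 0.
Proof. by rewrite -(scale0r (0 : L)) WprojZ scale0r. Qed.

Lemma Wproj_sum h p I (r : seq I) (P : pred I) (E : I -> L) :
  Wproj h p (\sum_(i <- r | P i) E i) = \sum_(i <- r | P i) Wproj h p (E i).
Proof. by apply: (big_morph _ (WprojD h p) (Wproj0 h p)). Qed.

Lemma Wproj_Ldiag h p f : Wproj h p (Ldiag n f) = 0.
Proof.
rewrite /Wproj big1// => j _.
by rewrite ffunE (Aext_map_diag _ (in_alg A1)) tau_diagM.
Qed.

Lemma Wproj_series h p l q : Wproj h p (series_of h l q) = series_of h l q p.
Proof.
rewrite /Wproj (eq_bigr _ (fun j _ => tau_diag_series _ h l q j)).
rewrite (bigD1 q)//= eqxx scale1r big1 ?addr0// => j /negPf ->.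
by rewrite scale0r.
Qed.

(** The complementary projection is computed with the dual family rbar, which is
    orthogonal to W(r). *)
Lemma Wproj_decomp h p v :
  Wproj h p v + diag n (fun k => LB (series_of (bar n s h) k p) v) = v p.
Proof.
have [N /(_ _ (leqnn N))[f vE]] := series_decomp bP sP h v.
have fE k q : LB (series_of (bar n s h) k q) v = f k q.
  rewrite vE (LBC bP) (LBDl bP) (LBC bP) (LB_series_Ldiag bP sP).
  rewrite (LB_lcombl bP) big1 ?addr0// => l _.
  by rewrite big1// => i _; rewrite (LB_series_bar bP sP) mulr0.
rewrite {1}vE WprojD Wproj_Ldiag add0r Wproj_sum [in RHS]vE ffunE addrC; congr (_ + _).
  by rewrite ffunE; congr diag; apply/funext => k; exact: fE.
rewrite sum_ffunE; apply: eq_bigr => k _; rewrite sum_ffunE Wproj_sum;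
  apply: eq_bigr => i _.
by rewrite WprojZ Wproj_series [RHS]ffunE.
Qed.

Variable h : gg_series F d.
Local Notation r := (series_of h).
Local Notation rbar := (series_of (bar n s h)).

Definition gcyb_psi : ggg_series F d := fun p q e k1 k2 k3 =>
  LB (rbar k1 p) (Lbr (r k2 q) (r k3 e)).

Local Notation inF c := (in_alg A2 (in_alg A1 c)).

(** The next three families are the coefficients of x_3^k3 in the
    b_p (x) b_q (x) b_e components of [r12, r13], [r12, r23] and [r13, rbar23]. *)
Definition coef12_13 p q e k3 : A2 := diag n (fun k2 => Lbr (r k2 q) (r k3 e) p).
Definition coef12_23 p q e k3 : A2 :=
  \sum_j \sum_i inF (sc j i q) * (diag n (fun k => r k j p) * M (r k3 e i)).
Definition coef13_23 p q e k3 : A2 :=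
  \sum_j \sum_i inF (sc j i e) *
    conv (fun k => in_alg A2 (r k j p)) (fun k => M (rbar k i q)) k3.
Definition coef_psi p q e k3 : A2 :=
  diag n (fun k2 => diag n (fun k1 => gcyb_psi p q e k1 k2 k3)).

Lemma tau_inF c x : tau (inF c * x) = c *: tau x.
Proof. by rewrite mulr_algl tauZ mulr_algl. Qed.

Lemma sum_delta1Z (V : lmodType F) (G : 'I_d -> V) i0 :
  \sum_i (i == i0)%:R *: G i = G i0.
Proof.
rewrite (bigD1 i0)//= eqxx scale1r big1 ?addr0// => i /negPf ->.
by rewrite scale0r.
Qed.

(** Pairing with x^m in the second variable selects, by duality, a single
    coefficient of r. *)
Lemma tau_xdiag_12_23 m p q e k3 : tau (xdiag n A1 m * coef12_23 p q e k3) =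
  \sum_j sc j e q *: conv (fun k => (k == m)%:R) (fun k => r k j p) k3.
Proof.
rewrite mulr_sumr tau_sum; apply: eq_bigr => j _; rewrite mulr_sumr tau_sum.
rewrite -(sum_delta1Z (fun i => sc j i q *:
  conv (fun k => (k == m)%:R) (fun k => r k j p) k3) e).
apply: eq_bigr => i _; rewrite mulrCA tau_inF mulrA diagM tau_diag_series.
by rewrite !scalerA mulrC.
Qed.

Lemma tau_xdiag_13_23 m p q e k3 : tau (xdiag n A1 m * coef13_23 p q e k3) =
  \sum_j sc j q e *: conv (fun k => (k == m)%:R) (fun k => r k j p) k3.
Proof.
rewrite mulr_sumr tau_sum; apply: eq_bigr => j _; rewrite mulr_sumr tau_sum.
rewrite -(sum_delta1Z (fun i => sc j i e *:
  conv (fun k => (k == m)%:R) (fun k => r k j p) k3) q).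
apply: eq_bigr => i _; rewrite mulrCA tau_inF [RHS]scalerA
  [(i == q)%:R * _]mulrC -scalerA; congr (_ *: _).
rewrite mulr_sumr tau_sum convC scaler_sumr; apply: eq_bigr => k _.
rewrite mulrCA mulr_algl tauZ tau_diag_series eq_sym -scalerAr.
by rewrite eq_sym.
Qed.

(** Summing over the basis of g in the second variable turns structure constants
    into the bracket of two generators, whose residue against r is its
    W-projection. *)
Lemma tau_M_12_23 m e0 p e k3 :
  \sum_q tau (M (r m e0 q) * coef12_23 p q e k3) = Wproj h p (Lbr (r k3 e) (r m e0)).
Proof.
rewrite (eq_bigr (fun q => \sum_j \sum_i
   sc j i q *: tau (diag n (fun k => r k j p) * M (r k3 e i * r m e0 q)))); last first.
  move=> q _; rewrite mulr_sumr tau_sum; apply: eq_bigr => j _; rewrite mulr_sumr tau_sum.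
  apply: eq_bigr => i _; rewrite mulrCA tau_inF.
  by rewrite (M_mulCA (r m e0 q) (r k3 e i)).
rewrite exchange_big /=; apply: eq_bigr => j _; rewrite exchange_big /= LbrE.
rewrite (Aext_map_sum (in_alg A1)) mulr_sumr tau_sum; apply: eq_bigr => i _.
rewrite (Aext_map_sum (in_alg A1)) mulr_sumr tau_sum; apply: eq_bigr => q _.
rewrite (Aext_mapZ (in_alg A1)) -scalerAr tauZ mulr_algl.
by rewrite (struct_const_cyclic brP bP).
Qed.

(** The pairings that occur are those of W(rbar) with W(r). *)
Lemma tau_M_13_23 m e0 p e k3 :
  \sum_q tau (M (r m e0 q) * coef13_23 p q e k3) = 0.
Proof.
rewrite (eq_bigr (fun q => \sum_j \sum_i \sum_(k < k3.+1)
   (sc j i e *: r k j p) * in_alg A1 (t (rbar (k3 - k)%N i q * r m e0 q)))); last first.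
  move=> q _; rewrite mulr_sumr tau_sum; apply: eq_bigr => j _; rewrite mulr_sumr tau_sum.
  apply: eq_bigr => i _; rewrite mulrCA tau_inF mulr_sumr tau_sum scaler_sumr.
  apply: eq_bigr => k _; rewrite -[RHS]scalerAl; congr (_ *: _).
  exact: tau_M_alg_M.
rewrite exchange_big /= big1// => j _; rewrite exchange_big /= big1// => i _.
rewrite exchange_big /= big1// => k _;
  rewrite -mulr_sumr -(rmorph_sum (in_alg A1)) -(LBE bP).
by rewrite (LBC bP) (LB_series_bar bP sP) rmorph0 mulr0.
Qed.

Lemma A2_eq (X1 X2 X3 X4 : 'I_d -> A2) :
  (forall m q, tau (xdiag n A1 m * X1 q) = 0) ->
  (forall m q, tau (xdiag n A1 m * X2 q) + tau (xdiag n A1 m * X3 q) = 0) ->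
  (forall m q, tau (xdiag n A1 m * X4 q) = 0) ->
  (forall m e, \sum_q tau (M (r m e q) * X1 q) + \sum_q tau (M (r m e q) * X2 q)
    + \sum_q tau (M (r m e q) * X3 q) = \sum_q tau (M (r m e q) * X4 q)) ->
  forall q, X1 q + X2 q + X3 q = X4 q.
Proof.
move=> x1 x23 x4 XW q; apply/eqP; rewrite -subr_eq0; apply/eqP; move: q.
have tauE (y : A2) q : tau (y * (X1 q + X2 q + X3 q - X4 q)) =
    tau (y * X1 q) + tau (y * X2 q) + tau (y * X3 q) - tau (y * X4 q).
  by rewrite mulrBr !mulrDr -[- (y * X4 q)]scaleN1r !tauD tauZ mulN1r.
apply: (@A2_eq0 h (fun q => X1 q + X2 q + X3 q - X4 q)) => [m q|m e].
  by rewrite tauE x1 x4 add0r x23 subr0.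
apply: (etrans (sum_addsub (fun q => tauE (M (r m e q)) q))).
by apply/eqP; rewrite subr_eq0; apply/eqP; exact: XW.
Qed.

Lemma tau_M_diag m e (c : 'I_d -> nat -> A1) :
  \sum_q tau (M (r m e q) * diag n (c q)) = c e m.
Proof.
rewrite -(sum_delta1Z (fun q => c q m)); apply: eq_bigr => q _.
by rewrite mulrC tau_diag_series.
Qed.

(** Against b_q x^m the terms of [r12, r23] and [r13, rbar23] cancel by
    antisymmetry of the structure constants.  Against the generators of W(r) the
    identity becomes the decomposition of a bracket along W(r) and the diagonal. *)
Lemma gcyb_coef p q e k3 : coef12_13 p q e k3 + coef12_23 p q e k3
  + coef13_23 p q e k3 = coef_psi p q e k3.
Proof.
apply: (@A2_eq (coef12_13 p ^~ e ^~ k3) (coef12_23 p ^~ e ^~ k3)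
  (coef13_23 p ^~ e ^~ k3) (coef_psi p ^~ e ^~ k3)) => {q}.
- by move=> m q; exact: tau_diagM.
- move=> m q; rewrite tau_xdiag_12_23 tau_xdiag_13_23 -big_split big1// => j _ /=.
  by rewrite -scalerDl (struct_const_cyclic brP bP j e) (struct_const_anti brP b e)
    (struct_const_cyclic brP bP j q) addNr scale0r.
- by move=> m q; exact: tau_diagM.
move=> m e0.
have E1 := tau_M_diag m e0 (fun q k2 => Lbr (r k2 q) (r k3 e) p).
have E4 := tau_M_diag m e0 (fun q k2 => diag n (fun k1 => gcyb_psi p q e k1 k2 k3)).
apply: (etrans (f_equal2 +%R
  (f_equal2 +%R E1 (tau_M_12_23 m e0 p e k3)) (tau_M_13_23 m e0 p e k3))).
apply: (etrans _ (esym E4)); rewrite addr0.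
rewrite [Lbr (r k3 e) _]Lbr_anti -scaleN1r WprojZ scaleN1r.
by rewrite -(Wproj_decomp h p (Lbr (r m e0) (r k3 e))) addrAC subrr add0r.
Qed.

End MainIdentity.

(** * The form on triple tensors *)

Lemma sum_delta3 (R : pzSemiRingType) (I : finType) (G : I -> I -> I -> R) p q r :
  \sum_p' \sum_q' \sum_r' G p' q' r' * ((p == p')%:R * (q == q')%:R * (r == r')%:R)
    = G p q r.
Proof.
rewrite (bigD1 p)//= [X in _ + X]big1 ?addr0 => [|p' /negPf pp]; last first.
  rewrite big1// => q' _; rewrite big1// => r' _.
  by rewrite [p == p']eq_sym pp !mul0r mulr0.
rewrite (bigD1 q)//= [X in _ + X]big1 ?addr0 => [|q' /negPf qq]; last first.
  by rewrite big1// => r' _; rewrite [q == q']eq_sym qq mulr0 mul0r mulr0.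
rewrite (bigD1 r)//= [X in _ + X]big1 ?addr0 => [|r' /negPf rr]; last first.
  by rewrite [r == r']eq_sym rr !mulr0.
by rewrite !eqxx !mulr1.
Qed.

(** The functional t_3 produces the sums over basis indices outside and those
    over exponents inside; expansions on the generators r_(k,i) interleave them. *)
Lemma exchange6 (V : nmodType) (I K : finType) (G : I -> I -> I -> K -> K -> K -> V) :
  \sum_p \sum_q \sum_r \sum_z \sum_y \sum_x G p q r x y z =
  \sum_x \sum_p \sum_y \sum_q \sum_z \sum_r G p q r x y z.
Proof.
do !rewrite pair_bigA /=.
rewrite (reindex (fun u : K * I * K * I * K * I =>
  let: (x, p, y, q, z, r) := u in (p, q, r, z, y, x))) /=.
  by apply: eq_bigr => -[[[[[x p] y] q] z] r] _.
exists (fun u : I * I * I * K * K * K =>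
  let: (p, q, r, z, y, x) := u in (x, p, y, q, z, r)).
  by move=> [[[[[x p] y] q] z] r] _.
by move=> [[[[[p q] r] z] y] x] _.
Qed.

Section TensorPairing.
Variables (F : fieldType) (g : vectType F) (br : g -> g -> g).
Hypothesis brP : lie_bracket br.
Variables (d : nat) (b : d.-tuple g).
Hypothesis bP : orthonormal_basis br b.
Variables (n : nat) (al : int -> F) (s : nat -> F).
Hypothesis sP : lser s * (lmono F n%:Z * alpha n al) = 1.

Local Notation A1 := (Aext n F).
Local Notation A2 := (Aext n A1).
Local Notation A3 := (Aext n A2).
Local Notation L := (Lalg F d n).
Local Notation pairx := (pairx al).
Local Notation LB := (LB br b al).
Local Notation Lbr := (Lbr br b).
Local Notation series_of := (mk_series b n s).
Implicit Types (u v : L) (h : gg_series F d) (f : nat -> 'I_d -> F).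
Implicit Types (k l m : nat) (i j p q : 'I_d).

Lemma t1_alg c (x : A1) : t1 al (in_alg A1 c * x) = c * t1 al x.
Proof. by rewrite mulr_algl t1Z. Qed.

Lemma t2D (x y : A2) : t2 al (x + y) = t2 al x + t2 al y.
Proof. exact: (@tnextD F n al A1 (in_alg A1) (t1 al) (@t1D F n al) t1_alg). Qed.

Lemma t2_alg c (x : A2) : t2 al ((in_alg A2 \o in_alg A1) c * x) = c * t2 al x.
Proof. by rewrite mulr_algl;
  exact: (@tnextZ F n al A1 (in_alg A1) (t1 al) (@t1D F n al) t1_alg). Qed.

(** Peels off the variables x_3, x_2 and x_1 in this order. *)
Lemma t3_diag (f1 f2 f3 : A1) : exists N, forall m, (N <= m)%N ->
  forall c : nat -> nat -> nat -> F,
  t3 al (var1 f1 * var2 f2 * var3 f3 *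
     diag n (fun z => diag n (fun y => diag n (fun x => c x y z)))) =
  \sum_(z < m) \sum_(y < m) \sum_(x < m)
    t1 al (xdiag n F x * f1) * (t1 al (xdiag n F y * f2) *
      (t1 al (xdiag n F z * f3) * c x y z)).
Proof.
have [N1 N1P] := tres_diagE (@alpha_ord F n al) f1.
have [N2 N2P] := @tnext_diag F n al A1 (in_alg A1) (t1 al) (@t1D F n al) t1_alg f2.
have [N3 N3P] := @tnext_diag F n al A2 (in_alg A2 \o in_alg A1) (t2 al) t2D t2_alg f3.
exists (maxn N1 (maxn N2 N3)) => m; rewrite !geq_max => /and3P[m1 m2 m3] c.
have -> : var1 f1 * var2 f2 * var3 f3 *
     diag n (fun z => diag n (fun y => diag n (fun x => c x y z))) =
  (in_alg A2 f1 * Aext_map (in_alg A1) f2) *: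
    (Aext_map (in_alg A2 \o in_alg A1) f3 *
       diag n (fun z => diag n (fun y => diag n (fun x => c x y z)))).
  by rewrite /var1 /var2 -rmorphM -mulrA mulr_algl.
apply: (etrans (N3P m m3 _ _)); apply: eq_bigr => z _.
have -> : in_alg A2 f1 * Aext_map (in_alg A1) f2
  * diag n (fun y => diag n (fun x => c x y z)) =
  f1 *: (Aext_map (in_alg A1) f2 * diag n (fun y => diag n (fun x => c x y z))).
  by rewrite -mulrA mulr_algl.
have E := N2P m m2 f1 (fun y => diag n (fun x => c x y z)).
rewrite (f_equal (fun X => _ * X) E) mulr_sumr; apply: eq_bigr => y _.
have [_ {}E] := N1P m m1.
have E1 : t1 al (diag n (fun x => c x y z) * f1) =
  \sum_(x < m) c x y z * t1 al (xdiag n F x * f1) := E (fun x => c x y z).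
rewrite [f1 * _]mulrC (f_equal (fun X => _ * (_ * X)) E1) !mulr_sumr.
by apply: eq_bigr => x _; ring.
Qed.

Lemma B3E (S T : g3A F d n) :
  B3 br b al S T = \sum_p \sum_q \sum_r t3 al (S p q r * T p q r).
Proof.
apply: eq_bigr => p _; apply: eq_bigr => q _; apply: eq_bigr => r _.
rewrite -(sum_delta3 (fun p' q' r' => t3 al (S p q r * T p' q' r')) p q r).
apply: eq_bigr => p' _; apply: eq_bigr => q' _; apply: eq_bigr => r' _.
by rewrite !(proj2 bP).
Qed.

Lemma B3_expand v1 v2 v3 : exists N, forall m, (N <= m)%N ->
  forall psi : ggg_series F d,
  B3 br b al (tensor3 v1 v2 v3) (ggg_diag n psi) =
  \sum_(x < m) \sum_p pairx v1 x p * \sum_(y < m) \sum_q pairx v2 y q *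
    \sum_(z < m) \sum_r pairx v3 z r * psi p q r x y z.
Proof.
have /choice[N NP] (pqr : 'I_d * 'I_d * 'I_d) :=
  t3_diag (v1 pqr.1.1) (v2 pqr.1.2) (v3 pqr.2).
exists (\max_u N u) => m Nm psi.
transitivity (\sum_(x < m) \sum_p \sum_(y < m) \sum_q \sum_(z < m) \sum_r
  pairx v1 x p * (pairx v2 y q * (pairx v3 z r * psi p q r x y z))); last first.
  apply: eq_bigr => x _; apply: eq_bigr => p _.
  rewrite mulr_sumr; apply: eq_bigr => y _; rewrite mulr_sumr; apply: eq_bigr => q _.
  rewrite 2!mulr_sumr; apply: eq_bigr => z _; rewrite 2!mulr_sumr; apply: eq_bigr => r _.
  by [].
rewrite B3E -exchange6.
apply: eq_bigr => p _; apply: eq_bigr => q _; apply: eq_bigr => r _.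
apply: (NP (p, q, r) m _ (psi p q r)).
by apply: leq_trans Nm; exact: leq_bigmax.
Qed.

Lemma Lbr_scaleDl c u u' v : Lbr (c *: u + u') v = c *: Lbr u v + Lbr u' v.
Proof.
have lcE (x y : L) i : (c *: x + y) i = c *: x i + y i by rewrite !ffunE.
apply/ffunP => p; rewrite lcE !LbrE scaler_sumr -big_split.
apply: eq_bigr => i _; rewrite scaler_sumr -big_split; apply: eq_bigr => j _.
by rewrite lcE mulrDl scalerDr -scalerAl !scalerA [c * _]mulrC.
Qed.

Lemma Lbr_scaleDr c u u' v : Lbr v (c *: u + u') = c *: Lbr v u + Lbr v u'.
Proof.
by rewrite (Lbr_anti brP) Lbr_scaleDl opprD -scalerN -!(Lbr_anti brP).
Qed.

Lemma linear_lcomb (T : L -> F) m f (r : series F d n) :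
  (forall c u v, T (c *: u + v) = c * T u + T v) ->
  T (\sum_(k < m) \sum_i f k i *: r k i) = \sum_(k < m) \sum_i f k i * T (r k i).
Proof.
move=> Tlin.
have TD u v : T (u + v) = T u + T v by have := Tlin 1 u v; rewrite scale1r mul1r.
have T0 : T 0 = 0 by apply: (addrI (T 0)); rewrite -TD !addr0.
rewrite (big_morph T TD T0); apply: eq_bigr => k _; rewrite (big_morph T TD T0).
by apply: eq_bigr => i _; have := Tlin (f k i) (r k i) 0; rewrite T0 !addr0.
Qed.

Variable h : gg_series F d.
Local Notation r := (series_of h).
Local Notation rbar := (series_of (bar n s h)).
Local Notation gcyb_psi := (gcyb_psi br b n al s h).

(** Both sides are trilinear, and they agree on generators by duality. *)
Lemma gcyb_psi_defines : defines_psi br b al r rbar gcyb_psi.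
Proof.
move=> v1 v2 v3 W1 W2 W3.
have [N1 N1P] := W_expand bP sP W1.
have [N2 N2P] := W_expand bP sP W2.
have [N3 N3P] := W_expand bP sP W3.
have [N NP] := B3_expand v1 v2 v3.
pose m := maxn (maxn N N1) (maxn N2 N3).
have [Nm N1m] : (N <= m)%N /\ (N1 <= m)%N by rewrite /m; lia.
have [N2m N3m] : (N2 <= m)%N /\ (N3 <= m)%N by rewrite /m; lia.
have [_ E1] := N1P m N1m; have [_ E2] := N2P m N2m; have [_ E3] := N3P m N3m.
have e3 u1 u2 : LB u1 (Lbr u2 v3)
  = \sum_(z < m) \sum_e pairx v3 z e * LB u1 (Lbr u2 (r z e)).
  rewrite {1}E3; apply: (linear_lcomb (T := fun u => LB u1 (Lbr u2 u))) => c u v.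
  by rewrite Lbr_scaleDr (LBC bP) (LBDl bP) (LBZl bP) ![LB _ u1](LBC bP).
have e2 u1 : LB u1 (Lbr v2 v3)
  = \sum_(y < m) \sum_q pairx v2 y q * LB u1 (Lbr (r y q) v3).
  rewrite {1}E2; apply: (linear_lcomb (T := fun u => LB u1 (Lbr u v3))) => c u v.
  by rewrite Lbr_scaleDl (LBC bP) (LBDl bP) (LBZl bP) ![LB _ u1](LBC bP).
rewrite (NP m Nm) [in RHS]E1 (LB_lcombl bP).
apply: eq_bigr => x _; apply: eq_bigr => p _.
rewrite e2; congr (_ * _); apply: eq_bigr => y _; apply: eq_bigr => q _.
by rewrite e3.
Qed.

Lemma sum_pairx_series h' m l q f : (l < m)%N ->
  \sum_(k < m) \sum_i pairx (series_of h' l q) k i * f k i = f l q.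
Proof.
move=> lm; have := sum_delta m f l q; rewrite lm => <-.
apply: eq_bigr => k _; apply: eq_bigr => i _.
by rewrite (pairx_series bP sP) mulrC [l == k]eq_sym [i == q]eq_sym.
Qed.

(** On generators the pairing with psi reads off a single coefficient. *)
Lemma defines_psi_coef psi p q e x y z : defines_psi br b al r rbar psi ->
  psi p q e x y z = gcyb_psi p q e x y z.
Proof.
move=> D; have [N NP] := B3_expand (rbar x p) (r y q) (r z e).
rewrite /gcyb_psi -(D _ _ _ (W_mem b n s _ x p) (W_mem b n s _ y q) (W_mem b n s _ z e)).
(* large enough for the expansion to hold and to reach all three exponents *)
pose m := maxn N (maxn x (maxn y z)).+1.
have [Nm xm] : (N <= m)%N /\ (x < m)%N by rewrite /m; lia.
have [ym zm] : (y < m)%N /\ (z < m)%N by rewrite /m; lia.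
rewrite (NP m Nm) (sum_pairx_series _ _ (fun x' p' =>
  \sum_(y' < m) \sum_q' pairx (r y q) y' q' *
    \sum_(z' < m) \sum_e' pairx (r z e) z' e' * psi p' q' e' x' y' z') xm).
rewrite (sum_pairx_series _ _ (fun y' q' =>
  \sum_(z' < m) \sum_e' pairx (r z e) z' e' * psi p q' e' x y' z') ym).
by rewrite (sum_pairx_series _ _ (fun z' e' => psi p q e' x y z') zm).
Qed.

Lemma gcyb_psi_unique : unique (defines_psi br b al r rbar) gcyb_psi.
Proof.
split; first exact: gcyb_psi_defines.
move=> psi D; apply/funext => p; apply/funext => q; apply/funext => e.
apply/funext => x; apply/funext => y; apply/funext => z.
by rewrite (defines_psi_coef _ _ _ _ _ _ D).
Qed.

End TensorPairing.

(** * Commutators in the triple enveloping algebra *)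

(** The three ways in which the two indices contracted by a structure constant
    are moved inside the sum, for the three commutators of GCYB. *)
Lemma reindex5 (V : nmodType) (I : finType) (X : I -> I -> I -> I -> I -> V) :
  [/\ \sum_p \sum_q \sum_p' \sum_q' \sum_a X p q p' q' a =
      \sum_a \sum_q \sum_q' \sum_p \sum_p' X p q p' q' a,
      \sum_p \sum_q \sum_p' \sum_q' \sum_a X p q p' q' a =
      \sum_p \sum_a \sum_q' \sum_q \sum_p' X p q p' q' a
    & \sum_p \sum_q \sum_p' \sum_q' \sum_a X p q p' q' a =
      \sum_p \sum_p' \sum_a \sum_q \sum_q' X p q p' q' a].
Proof.
do !rewrite pair_bigA /=; split.
- rewrite (reindex (fun u : I * I * I * I * I =>
    let: (a, q, q', p, p') := u in (p, q, p', q', a))) /=.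
    by apply: eq_bigr => -[[[[a q] q'] p] p'] _.
  exists (fun u : I * I * I * I * I => let: (p, q, p', q', a) := u in (a, q, q', p, p'));
    by move=> [[[[? ?] ?] ?] ?] _.
- rewrite (reindex (fun u : I * I * I * I * I =>
    let: (p, a, q', q, p') := u in (p, q, p', q', a))) /=.
    by apply: eq_bigr => -[[[[p a] q'] q] p'] _.
  exists (fun u : I * I * I * I * I => let: (p, q, p', q', a) := u in (p, a, q', q, p'));
    by move=> [[[[? ?] ?] ?] ?] _.
rewrite (reindex (fun u : I * I * I * I * I =>
  let: (p, p', a, q, q') := u in (p, q, p', q', a))) /=.
  by apply: eq_bigr => -[[[[p p'] a] q] q'] _.
exists (fun u : I * I * I * I * I => let: (p, q, p', q', a) := u in (p, p', a, q, q'));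
  by move=> [[[[? ?] ?] ?] ?] _.
Qed.

Section Enveloping.
Variables (F : fieldType) (g : vectType F) (br : g -> g -> g).
Variables (d : nat) (b : d.-tuple g).
Hypothesis bP : orthonormal_basis br b.
Variable n : nat.

Local Notation A1 := (Aext n F).
Local Notation A2 := (Aext n A1).
Local Notation A3 := (Aext n A2).
Local Notation U := (U br).
Local Notation U3A := (U3A br n).
Local Notation pure3 := (@pure3 F g br n).
Local Notation sc := (struct_const br b).
Local Notation iota i := (uea_gen br (tnth b i)).
Implicit Types (x y z : U) (f : A3) (c : F) (p q i j : 'I_d).

Lemma pure3Dx x x' y z f : pure3 (x + x') y z f = pure3 x y z f + pure3 x' y z f.
Proof. by rewrite /Defs.pure3 !tensorDl. Qed.
Lemma pure3Dy x y y' z f : pure3 x (y + y') z f = pure3 x y z f + pure3 x y' z f.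
Proof. by rewrite /Defs.pure3 tensorDr !tensorDl. Qed.
Lemma pure3Dz x y z z' f : pure3 x y (z + z') f = pure3 x y z f + pure3 x y z' f.
Proof. by rewrite /Defs.pure3 tensorDr !tensorDl. Qed.
Lemma pure3Df x y z f f' : pure3 x y z (f + f') = pure3 x y z f + pure3 x y z f'.
Proof. by rewrite /Defs.pure3 tensorDr. Qed.

(** Scalars of F can be moved from any enveloping algebra factor to A_3. *)
Lemma pure3Zx c x y z f : pure3 (uea_cst br c * x) y z f = pure3 x y z (F_A3 F n c * f).
Proof.
rewrite /Defs.pure3 tensorZl.
rewrite (tensorZl (UU_cst br) (uea_cst br) c).
by rewrite (tensorZl (UUU_cst br) (F_A3 F n) c) -tensorZr.
Qed.
Lemma pure3Zy c x y z f : pure3 x (uea_cst br c * y) z f = pure3 x y z (F_A3 F n c * f).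
Proof.
rewrite /Defs.pure3 tensorZr.
rewrite (tensorZl (UU_cst br) (uea_cst br) c).
by rewrite (tensorZl (UUU_cst br) (F_A3 F n) c) -tensorZr.
Qed.
Lemma pure3Zz c x y z f : pure3 x y (uea_cst br c * z) f = pure3 x y z (F_A3 F n c * f).
Proof.
rewrite /Defs.pure3 (tensorZr (UU_cst br) (uea_cst br) c).
by rewrite (tensorZl (UUU_cst br) (F_A3 F n) c) -tensorZr.
Qed.

Lemma pure3M x y z f x' y' z' f' :
  pure3 x y z f * pure3 x' y' z' f' = pure3 (x * x') (y * y') (z * z') (f * f').
Proof. by rewrite /Defs.pure3 !tensorM. Qed.

Lemma additive_sum (V W : zmodType) (T : V -> W) I (r : seq I) (P : pred I) (E : I -> V) :
  (forall u v, T (u + v) = T u + T v) ->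
  T (\sum_(i <- r | P i) E i) = \sum_(i <- r | P i) T (E i).
Proof.
move=> TD; have T0 : T 0 = 0 by apply: (addrI (T 0)); rewrite -TD !addr0.
exact: (big_morph T TD T0).
Qed.

Lemma additiveB (V W : zmodType) (T : V -> W) u v :
  (forall u v, T (u + v) = T u + T v) -> T (u - v) = T u - T v.
Proof. by move=> TD; apply/eqP; rewrite eq_sym subr_eq -TD subrK. Qed.

Lemma uea_genD (u v : g) : uea_gen br (u + v) = uea_gen br u + uea_gen br v.
Proof. by have := uea_genP br 1 u v; rewrite scale1r rmorph1 mul1r. Qed.

Lemma iota_comm p q : iota p * iota q - iota q * iota p
  = \sum_a uea_cst br (sc p q a) * iota a.
Proof.
rewrite -uea_gen_bracket {1}(coord_basis (proj1 bP) (memvf (br _ _))).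
rewrite (additive_sum _ _ _ uea_genD); apply: eq_bigr => a _.
have := uea_genP br (sc p q a) (tnth b a) 0.
have -> : uea_gen br 0 = 0 by apply: (addrI (uea_gen br 0)); rewrite -uea_genD !addr0.
by rewrite !addr0 -tnth_nth.
Qed.

Lemma comm_suml (I : finType) (E : I -> U3A) (y : U3A) :
  comm (\sum_i E i) y = \sum_i comm (E i) y.
Proof. by rewrite /comm mulr_suml mulr_sumr sumrB. Qed.

Lemma comm_sumr (I : finType) (E : I -> U3A) (y : U3A) :
  comm y (\sum_i E i) = \sum_i comm y (E i).
Proof. by rewrite /comm mulr_suml mulr_sumr sumrB. Qed.

(** Two pure tensors that overlap in one slot commute up to the bracket in that
    slot, because A_3 is commutative and the other slots contain a unit. *)
Lemma comm_12_13 p q p' q' f f' :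
  comm (pure3 (iota p) (iota q) 1 f) (pure3 (iota p') 1 (iota q') f') =
  \sum_a pure3 (iota a) (iota q) (iota q') (F_A3 F n (sc p p' a) * (f * f')).
Proof.
rewrite /comm !pure3M !mulr1 !mul1r [f' * f]mulrC.
have D := fun u v => pure3Dx u v (iota q) (iota q') (f * f').
rewrite -(additiveB _ _ D) iota_comm (additive_sum _ _ _ D).
by apply: eq_bigr => a _; rewrite pure3Zx.
Qed.

Lemma comm_12_23 p q p' q' f f' :
  comm (pure3 (iota p) (iota q) 1 f) (pure3 1 (iota p') (iota q') f') =
  \sum_a pure3 (iota p) (iota a) (iota q') (F_A3 F n (sc q p' a) * (f * f')).
Proof.
rewrite /comm !pure3M !mulr1 !mul1r [f' * f]mulrC.
have D := fun u v => pure3Dy (iota p) u v (iota q') (f * f').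
rewrite -(additiveB _ _ D) iota_comm (additive_sum _ _ _ D).
by apply: eq_bigr => a _; rewrite pure3Zy.
Qed.

Lemma comm_13_23 p q p' q' f f' :
  comm (pure3 (iota p) 1 (iota q) f) (pure3 1 (iota p') (iota q') f') =
  \sum_a pure3 (iota p) (iota p') (iota a) (F_A3 F n (sc q q' a) * (f * f')).
Proof.
rewrite /comm !pure3M !mulr1 !mul1r [f' * f]mulrC.
have D := fun u v => pure3Dz (iota p) (iota p') u v (f * f').
rewrite -(additiveB _ _ D) iota_comm (additive_sum _ _ _ D).
by apply: eq_bigr => a _; rewrite pure3Zz.
Qed.

Local Notation T12 f := (\sum_p \sum_q pure3 (iota p) (iota q) 1 (f p q)).
Local Notation T13 f := (\sum_p \sum_q pure3 (iota p) 1 (iota q) (f p q)).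
Local Notation T23 f := (\sum_p \sum_q pure3 1 (iota p) (iota q) (f p q)).

Lemma comm_sums (E E' : 'I_d -> 'I_d -> U3A) :
  comm (\sum_p \sum_q E p q) (\sum_p \sum_q E' p q) =
  \sum_p \sum_q \sum_p' \sum_q' comm (E p q) (E' p' q').
Proof.
rewrite comm_suml; apply: eq_bigr => p _; rewrite comm_suml; apply: eq_bigr => q _.
by rewrite comm_sumr; apply: eq_bigr => p' _; rewrite comm_sumr.
Qed.

Lemma pure3_sumf x y z I (r : seq I) (P : pred I) (E : I -> A3) :
  pure3 x y z (\sum_(i <- r | P i) E i) = \sum_(i <- r | P i) pure3 x y z (E i).
Proof. by rewrite (additive_sum _ _ _ (pure3Df x y z)). Qed.

Lemma comm_T12_T13 (f f' : 'I_d -> 'I_d -> A3) :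
  comm (T12 f) (T13 f') = g3A_U3A br b (fun a q q' =>
    \sum_p \sum_p' F_A3 F n (sc p p' a) * (f p q * f' p' q')).
Proof.
rewrite comm_sums.
transitivity (\sum_p \sum_q \sum_p' \sum_q' \sum_a
   pure3 (iota a) (iota q) (iota q') (F_A3 F n (sc p p' a) * (f p q * f' p' q'))).
  apply: eq_bigr => p _; apply: eq_bigr => q _.
  apply: eq_bigr => p' _; apply: eq_bigr => q' _.
  exact: comm_12_13.
have [-> _ _] := reindex5 (fun p q p' q' a =>
   pure3 (iota a) (iota q) (iota q') (F_A3 F n (sc p p' a) * (f p q * f' p' q'))).
apply: eq_bigr => a _; apply: eq_bigr => q _; apply: eq_bigr => q' _.
by rewrite pure3_sumf; apply: eq_bigr => p _; rewrite pure3_sumf.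
Qed.

Lemma comm_T12_T23 (f f' : 'I_d -> 'I_d -> A3) :
  comm (T12 f) (T23 f') = g3A_U3A br b (fun p a q' =>
    \sum_q \sum_p' F_A3 F n (sc q p' a) * (f p q * f' p' q')).
Proof.
rewrite comm_sums.
transitivity (\sum_p \sum_q \sum_p' \sum_q' \sum_a
   pure3 (iota p) (iota a) (iota q') (F_A3 F n (sc q p' a) * (f p q * f' p' q'))).
  apply: eq_bigr => p _; apply: eq_bigr => q _.
  apply: eq_bigr => p' _; apply: eq_bigr => q' _.
  exact: comm_12_23.
have [_ -> _] := reindex5 (fun p q p' q' a =>
   pure3 (iota p) (iota a) (iota q') (F_A3 F n (sc q p' a) * (f p q * f' p' q'))).
apply: eq_bigr => p _; apply: eq_bigr => a _; apply: eq_bigr => q' _.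
by rewrite pure3_sumf; apply: eq_bigr => q _; rewrite pure3_sumf.
Qed.

Lemma comm_T13_T23 (f f' : 'I_d -> 'I_d -> A3) :
  comm (T13 f) (T23 f') = g3A_U3A br b (fun p p' a =>
    \sum_q \sum_q' F_A3 F n (sc q q' a) * (f p q * f' p' q')).
Proof.
rewrite comm_sums.
transitivity (\sum_p \sum_q \sum_p' \sum_q' \sum_a
   pure3 (iota p) (iota p') (iota a) (F_A3 F n (sc q q' a) * (f p q * f' p' q'))).
  apply: eq_bigr => p _; apply: eq_bigr => q _.
  apply: eq_bigr => p' _; apply: eq_bigr => q' _.
  exact: comm_13_23.
have [_ _ ->] := reindex5 (fun p q p' q' a =>
   pure3 (iota p) (iota p') (iota a) (F_A3 F n (sc q q' a) * (f p q * f' p' q'))).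
apply: eq_bigr => p _; apply: eq_bigr => p' _; apply: eq_bigr => a _.
by rewrite pure3_sumf; apply: eq_bigr => q _; rewrite pure3_sumf.
Qed.

Lemma g3A_U3AD (S T : g3A F d n) :
  g3A_U3A br b (fun p q e => S p q e + T p q e) = g3A_U3A br b S + g3A_U3A br b T.
Proof.
rewrite -big_split; apply: eq_bigr => p _; rewrite -big_split; apply: eq_bigr => q _.
rewrite -big_split; apply: eq_bigr => e _; exact: pure3Df.
Qed.

End Enveloping.

(** * The generalized Yang-Baxter equation *)

Section Final.
Variables (F : fieldType) (g : vectType F) (br : g -> g -> g).
Hypothesis brP : lie_bracket br.
Variables (d : nat) (b : d.-tuple g).
Hypothesis bP : orthonormal_basis br b.
Variables (n : nat) (al : int -> F) (s : nat -> F).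
Hypothesis sP : lser s * (lmono F n%:Z * alpha n al) = 1.
Variable h : gg_series F d.
Local Notation A1 := (Aext n F).
Local Notation A2 := (Aext n A1).
Local Notation A3 := (Aext n A2).
Local Notation r := (mk_series b n s h).
Local Notation rbar := (mk_series b n s (bar n s h)).
Local Notation sc := (struct_const br b).

Lemma F_A3_diag c (z : nat -> A2) :
  F_A3 F n c * diag n z = diag n (fun k => in_alg A2 (in_alg A1 c) * z k).
Proof. exact: mul_alg_diag. Qed.

Lemma F_A3_alg_diag c (y : A2) (z : nat -> A2) : F_A3 F n c * (in_alg A3 y * diag n z) =
  diag n (fun k => in_alg A2 (in_alg A1 c) * (y * z k)).
Proof.
have -> : in_alg A3 y * diag n z = diag n (fun k => y * z k) by exact: mul_alg_diag.
exact: F_A3_diag.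
Qed.

Lemma comm12_13_diag a q q' : \sum_p \sum_p' F_A3 F n (sc p p' a) *
    (in_alg A3 (diag n (fun k => r k q p)) * diag n (fun k => in_alg A2 (r k q' p')))
  = diag n (coef12_13 br b n s h a q q').
Proof.
rewrite /coef12_13; transitivity (diag n (fun k3 =>
  \sum_p \sum_p' in_alg A2 (in_alg A1 (sc p p' a)) *
    (diag n (fun k => r k q p) * in_alg A2 (r k3 q' p')))).
  rewrite diag_sum; apply: eq_bigr => p _; rewrite diag_sum; apply: eq_bigr => p' _.
  exact: F_A3_alg_diag.
congr diag; apply/funext => k3.
transitivity (diag n (fun k2 => \sum_p \sum_p' in_alg A1 (sc p p' a) *
  (r k2 q p * r k3 q' p'))).
  rewrite diag_sum; apply: eq_bigr => p _; rewrite diag_sum; apply: eq_bigr => p' _.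
  rewrite [diag n _ * _]mulrC !mul_alg_diag; congr diag; apply/funext => k2.
  by rewrite [r k3 _ _ * _]mulrC.
congr diag; apply/funext => k2; rewrite LbrE; apply: eq_bigr => p _;
  apply: eq_bigr => p' _.
by rewrite mulr_algl.
Qed.

Lemma comm12_23_diag p a q' : \sum_q \sum_p' F_A3 F n (sc q p' a) *
    (in_alg A3 (diag n (fun k => r k q p))
      * diag n (fun k => Aext_map (in_alg A1) (r k q' p')))
  = diag n (coef12_23 br b n s h p a q').
Proof.
rewrite /coef12_23 diag_sum; apply: eq_bigr => q _; rewrite diag_sum;
  apply: eq_bigr => p' _.
exact: F_A3_alg_diag.
Qed.

Lemma comm13_23_diag p p' a : \sum_q \sum_q' F_A3 F n (sc q q' a) *
    (diag n (fun k => in_alg A2 (r k q p))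
      * diag n (fun k => Aext_map (in_alg A1) (rbar k q' p')))
  = diag n (coef13_23 br b n s h p p' a).
Proof.
rewrite /coef13_23 diag_sum; apply: eq_bigr => q _; rewrite diag_sum;
  apply: eq_bigr => q' _.
by rewrite diagM F_A3_diag.
Qed.

Lemma GCYB_psi : GCYB br b r rbar = g3A_U3A br b (ggg_diag n (gcyb_psi br b n al s h)).
Proof.
rewrite /GCYB (comm_T12_T13 bP (fun p q => in_alg A3 (diag n (fun k => r k q p)))
  (fun p q => diag n (fun k => in_alg A2 (r k q p)))).
rewrite (comm_T12_T23 bP (fun p q => in_alg A3 (diag n (fun k => r k q p)))
  (fun p q => diag n (fun k => Aext_map (in_alg A1) (r k q p)))).
rewrite (comm_T13_T23 bP (fun p q => diag n (fun k => in_alg A2 (r k q p)))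
  (fun p q => diag n (fun k => Aext_map (in_alg A1) (rbar k q p)))).
rewrite -!g3A_U3AD; congr g3A_U3A.
apply/funext => p; apply/funext => q; apply/funext => e.
apply: (etrans (f_equal2 +%R
  (f_equal2 +%R (comm12_13_diag p q e) (comm12_23_diag p q e))
  (comm13_23_diag p q e))).
rewrite -!diagD; congr diag; apply/funext => k3.
exact: (gcyb_coef brP bP sP).
Qed.

End Final.

Theorem theorem1 (F : closedFieldType) (charF : [pchar F] =i pred0)
    (g : vectType F) (br : g -> g -> g)
    (brP : lie_bracket br) (br_simple : lie_simple br)
    (d : nat) (b : d.-tuple g) (bP : orthonormal_basis br b)
    (n : nat) (al : int -> F)
    (s : nat -> F) (sP : lser s * (lmono F n%:Z * alpha n al) = 1) :
  [/\ set_bij (type_series b n s)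
         [set V | subspace V /\ direct_sum Delta V] W,
      forall h : gg_series F d,
        Lorthog br b al (W (mk_series b n s h))
        = W (mk_series b n s (bar n s h))
    & forall h : gg_series F d,
        let r := mk_series b n s h in
        let rbar := mk_series b n s (bar n s h) in
        exists psi : ggg_series F d,
          unique (defines_psi br b al r rbar) psi /\
          GCYB br b r rbar = g3A_U3A br b (ggg_diag n psi) ].
Proof.
split.
- exact: (W_bij bP sP).
- by move=> h; exact: (W_orthog bP sP).
move=> h r rbar; exists (gcyb_psi br b n al s h); split.
  exact: (gcyb_psi_unique brP bP sP).
exact: (GCYB_psi brP bP sP).
Qed.
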